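(* There are systems $A\mathbf{x} \leq \mathbf{b}$ defining polytopes contained in the unit cube $C_n = [0,1]^n$ whose small Chvátal ranks are at least $n/2 - o(n)$. That is, there is a function $f$ with $f(n)/n \to 0$ as $n \to \infty$ such that for every $n$ there is a system $A\mathbf{x} \leq \mathbf{b}$, with $A$ an integer matrix with $n$ columns, rank $n$ and primitive rows and $\mathbf{b}$ an integer vector, such that $\{\mathbf{x} \in \mathbb{R}^n : A\mathbf{x} \leq \mathbf{b}\} \subseteq [0,1]^n$ and the small Chvátal rank of $A\mathbf{x} \leq \mathbf{b}$ is at least $n/2 - f(n)$.
   Context: A vector in $\mathbb{Z}^n$ is primitive if the gcd of its components is one. For $A \in \mathbb{Z}^{m \times n}$ of rank $n$ with primitive rows, let $\mathcal{A}$ be the set of rows of $A$. A basis in a set of vectors of $\mathbb{Z}^n$ is a subset of $n$ linearly independent vectors, and the cone generated by it is a basis cone. The minimal Hilbert basis of a pointed rational cone $K$ is the unique minimal finite set $H \subset K \cap \mathbb{Z}^n$ such that every element of $K \cap \mathbb{Z}^n$ is a nonnegative integer combination of elements of $H$. Set $\mathcal{A}^{(0)} = \mathcal{A}$, and for $k \geq 1$ let $\mathcal{A}^{(k)}$ be the union of the minimal Hilbert bases of all basis cones of $\mathcal{A}^{(k-1)}$; $A^{(k)}$ denotes a matrix whose rows are the elements of $\mathcal{A}^{(k)}$. With $Q_{\mathbf{b}} = \{\mathbf{x} \in \mathbb{R}^n : A\mathbf{x} \leq \mathbf{b}\}$ and $Q_{\mathbf{b}}^I = \mathrm{conv}(Q_{\mathbf{b}}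 \cap \mathbb{Z}^n)$, the small Chvátal rank of $A\mathbf{x} \leq \mathbf{b}$ is the smallest $k$ such that there is an integer vector $\mathbf{b}'$ with $Q_{\mathbf{b}}^I = \{\mathbf{x} : A^{(k)}\mathbf{x} \leq \mathbf{b}'\}$. *)

(* Defs.v *)
From HB Require Import structures.
From mathcomp Require Import all_boot all_order all_algebra finmap.
From mathcomp Require Import all_classical all_reals all_analysis.

Set Implicit Arguments.
Unset Strict Implicit.
Unset Printing Implicit Defensive.

Import Order.TTheory GRing.Theory Num.Theory.
Import numFieldNormedType.Exports.

Local Open Scope classical_set_scope.
Local Open Scope ring_scope.

(* Points x of R^n are column vectors; rows of A, and more generally the
   normal vectors making up the iterates of A, are row vectors. *)

Definition primitive n (v : 'rV[int]_n) : Prop :=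
  (\big[gcdn/0]_(i < n) `|v ord0 i|)%N = 1%N.

Definition rows_of m n (A : 'M[int]_(m, n)) : set 'rV[int]_n :=
  [set v | exists i, v = row i A].

Section RealGeometry.
Variable R : realType.

Definition real_mx m n (A : 'M[int]_(m, n)) : 'M[R]_(m, n) :=
  map_mx (fun z : int => z%:~R) A.

Definition polyhedron m n (A : 'M[int]_(m, n)) (b : 'cV[int]_m) :
    set 'cV[R]_n :=
  [set x | forall i, (real_mx A *m x) i ord0 <= (b i ord0)%:~R].

Definition unit_cube n : set 'cV[R]_n :=
  [set x | forall i, 0 <= x i ord0 <= 1].

Definition integer_points n : set 'cV[R]_n := range (@real_mx n 1).

Definition conv_hull n (X : set 'cV[R]_n) : set 'cV[R]_n :=
  [set x | exists (k : nat) (p : 'I_k -> 'cV[R]_n) (w : 'I_k -> R),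
    [/\ forall i, X (p i), forall i, 0 <= w i, \sum_(i < k) w i = 1
      & x = \sum_(i < k) w i *: p i]].

Definition integer_hull m n (A : 'M[int]_(m, n)) (b : 'cV[int]_m) :
    set 'cV[R]_n :=
  conv_hull (polyhedron A b `&` @integer_points n).

(* A basis in S, listed as the rows of a square matrix; independence forces
   these rows to be distinct. *)
Definition basis_in n (S : set 'rV[int]_n) (B : 'M[int]_n) : Prop :=
  rows_of B `<=` S /\ row_free (real_mx B).

Definition cone_of n (B : 'M[int]_n) : set 'rV[R]_n :=
  [set y | exists c : 'rV[R]_n,
    (forall i, 0 <= c ord0 i) /\ y = c *m real_mx B].

Definition hilbert_basis n (K : set 'rV[R]_n) (H : {fset 'rV[int]_n}) : Prop :=
  (forall h, h \in H -> K (real_mx h)) /\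
  (forall v : 'rV[int]_n, K (real_mx v) ->
     exists c : 'rV[int]_n -> nat, v = \sum_(h <- H) h *+ c h).

(* Inclusion-minimality; for a pointed rational cone such an H is unique. *)
Definition min_hilbert_basis n (K : set 'rV[R]_n) (H : {fset 'rV[int]_n}) :
    Prop :=
  hilbert_basis K H /\
  forall H' : {fset 'rV[int]_n},
    hilbert_basis K H' -> (H' `<=` H)%fset -> H' = H.

Definition hilbert_step n (S : set 'rV[int]_n) : set 'rV[int]_n :=
  [set v | exists (B : 'M[int]_n) (H : {fset 'rV[int]_n}),
    [/\ basis_in S B, min_hilbert_basis (cone_of B) H & v \in H]].

Definition hilbert_iter m n (A : 'M[int]_(m, n)) (k : nat) : set 'rV[int]_n :=
  iter k (@hilbert_step n) (rows_of A).

Definition describes_hull_at m n (A : 'M[int]_(m, n)) (b : 'cV[int]_m)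
    (k : nat) : Prop :=
  exists (p : nat) (Ak : 'M[int]_(p, n)) (b' : 'cV[int]_p),
    rows_of Ak = hilbert_iter A k /\ integer_hull A b = polyhedron Ak b'.

Definition is_small_chvatal_rank m n (A : 'M[int]_(m, n)) (b : 'cV[int]_m)
    (k : nat) : Prop :=
  describes_hull_at A b k /\
  forall j, describes_hull_at A b j -> (k <= j)%N.

End RealGeometry.

Arguments real_mx R {m n} A.
Arguments polyhedron R {m n} A b.
Arguments unit_cube R n : clear implicits.
Arguments integer_points R n : clear implicits.
Arguments basis_in R {n} S B.
Arguments cone_of R {n} B.
Arguments hilbert_step R {n} S.
Arguments hilbert_iter R {m n} A k.
Arguments integer_hull R {m n} A b.
Arguments describes_hull_at R {m n} A b k.
Arguments is_small_chvatal_rank R {m n} A b k.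

(* Main.v *)
Require Import Defs.
From HB Require Import structures.
From mathcomp Require Import all_boot all_order all_algebra finmap.
From mathcomp Require Import all_classical all_reals all_analysis.
From mathcomp Require Import ring lra zify.

Import Order.TTheory GRing.Theory Num.Theory.
Import numFieldNormedType.Exports.

Local Open Scope classical_set_scope.
Local Open Scope ring_scope.

Set Implicit Arguments.
Unset Strict Implicit.
Unset Printing Implicit Defensive.

(** The small Chvatal rank is large because Hilbert bases cannot create large
    numbers quickly.  An element of the minimal Hilbert basis of a basis cone
    is a combination of the n generators with coefficients in [0, 1]
    ([min_hilbert_basis_le1]), so one step multiplies the largest entry by at
    most n, and if the rows of A have entries in {-1, 0, 1} then the k-th
    iterate has entries at most n ^ k.  It remains to find a polytope in the
    unit cube, cut out by such rows, whose integer hull has a facet whose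
    normal cannot be scaled to an integer vector with entries below
    n ^ (n/2 - o(n)).

    The facet.  Take the simplex with vertices 0 and the rows of an invertible
    0/1 matrix Z.  If Z v is a unit vector, then v is normal to the facet
    spanned by all vertices but one; if v has an entry equal to 1 and an entry
    of absolute value at least X, then every nonzero multiple of v with integer
    entries has an entry of absolute value at least X, whence X <= n ^ k
    ([simplex_rank_lower_bound]).  The simplex is the integer hull of the cube
    intersected with one inequality with +-1 coefficients for every 0/1 point
    to be removed.

    The matrix (in the spirit of Hastad and of Alon and Vu).  Let
    chi_0, ..., chi_(N-1) be the rows of the Sylvester-Hadamard matrix of order
    N = 2^m.  A +-1 matrix G and a vector x with G x = +-1 are built one row at
    a time so that y_a = <chi_a, x> grows.  For a with d binary digits equal to
    1 there are D = 2^(d-1) sign vectors g_s, with Fourier support in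
    {0, ..., a}, whose sum is (D-1) chi_(a-1) - chi_a.  Averaging over s, some
    g_s can be made the new row with y_a >= (D-1) y_(a-1) + 1
    ([growing_system]); as the digits sum to m 2^(m-1), the product of the D's
    is N^(N/2) up to a factor exponential in N.  Such relations are produced by
    the doubling of Hadamard matrices, without mentioning digits.  The result
    is turned into a 0/1 matrix of order N+1 ([amplifier_sign_mx]), and an
    arbitrary order n is reached by chaining many blocks of order N+1 with
    log N ~ log n and N = o(n) ([solves_unit_glue], [large_amplifier]).

    Existence of the rank.  Some iterate must describe the integer hull, which
    is shown with a calculus of derivations: [derives beta T w m] says that
    w x <= m is a nonnegative combination of the inequalities t x <= beta t,
    t in T, where beta is the support function of the integer points.  An
    optimal combination can be supported on a basis of T, and expanding an
    integer w in the Hilbert basis of that basis cone shows that one Hilbert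
    step performs one Chvatal-Gomory rounding ([derives_round]).  For subsets
    of the cube, finitely many roundings prove every valid integer inequality
    ([derives_complete]); applied to the facets of the simplex this gives a
    finite rank. *)

(** * Sign vectors expressing a row of a Hadamard matrix by an earlier one *)
Section Hadamard.
Variable R : realFieldType.

Definition sign_mx m n (A : 'M[R]_(m, n)) : Prop :=
  forall i j, A i j = 1 \/ A i j = -1.

Definition hadamard N (H : 'M[R]_N) : Prop :=
  [/\ sign_mx H, H *m H^T = (N%:R)%:M
    & forall (i : 'I_N) j, i = 0%N :> nat -> H i j = 1].

(** The coordinates of [g *m H^T] are the Fourier coefficients of [g], so that
    the last condition reads: [g s] lies in the span of the first [a.+1] rows
    of [H].  Because the coefficient at [a] is the same for all [s], requiring
    one of the [g s] to take a prescribed value fixes the value of [row a H],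
    and the sum relation lets the best [s] gain a factor about [D - 1] over the
    value of [row p H]. *)
Definition growth_link N (H : 'M[R]_N) (a p : 'I_N) (D : nat) : Prop :=
  [/\ (p < a)%N, (0 < D)%N & exists g : 'I_D -> 'rV[R]_N,
    [/\ forall s, sign_mx (g s),
        \sum_s g s = (D%:R - 1) *: row p H - row a H,
        forall s, (g s *m H^T) 0 a = - (N%:R / D%:R)
      & forall s (c : 'I_N), (a < c)%N -> (g s *m H^T) 0 c = 0]].

Lemma hadamard_dot N (H : 'M[R]_N) (a c : 'I_N) : hadamard H ->
  (row a H *m H^T) 0 c = N%:R *+ (a == c).
Proof. by case=> _ HH _; rewrite -row_mul HH !mxE. Qed.

Lemma sign_mxN m n (A : 'M[R]_(m, n)) : sign_mx A -> sign_mx (- A).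
Proof.
by move=> sA i j; rewrite mxE; case: (sA i j) => ->; [right | left];
  rewrite ?opprK.
Qed.

Lemma sign_row_mx m n1 n2 (A : 'M[R]_(m, n1)) (B : 'M[R]_(m, n2)) :
  sign_mx A -> sign_mx B -> sign_mx (row_mx A B).
Proof. by move=> sA sB i j; rewrite mxE; case: fintype.split. Qed.

Lemma sign_row m n (A : 'M[R]_(m, n)) a : sign_mx A -> sign_mx (row a A).
Proof. by move=> sA i j; rewrite mxE. Qed.

(** With a single sign vector nothing is gained: the value at [a] is reset. *)
Lemma growth_link_trivial N (H : 'M[R]_N) (a p : 'I_N) : hadamard H -> (p < a)%N ->
  growth_link H a p 1.
Proof.
move=> WH pa; split=> //; exists (fun=> - row a H); split=> [s||s|s c ac].
- by apply/sign_mxN/sign_row; case: WH.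
- by rewrite big_ord1 subrr scale0r sub0r.
- by rewrite mulNmx mxE hadamard_dot// eqxx mulr1n divr1.
- by rewrite mulNmx mxE hadamard_dot// -val_eqE /= ltn_eqF// mulr0n oppr0.
Qed.

(** On functions, this passes from a set X to X x {+1, -1}: the first [N] rows
    are the old ones, constant in the new sign, and the last [N] are the old
    ones multiplied by it. *)
Definition sylvester N (H : 'M[R]_N) : 'M[R]_(N + N) := block_mx H H H (- H).

Lemma row_sylvester_l N (H : 'M[R]_N) a :
  row (lshift N a) (sylvester H) = row_mx (row a H) (row a H).
Proof. by rewrite /sylvester /block_mx rowKu row_row_mx. Qed.

Lemma row_sylvester_r N (H : 'M[R]_N) a :
  row (rshift N a) (sylvester H) = row_mx (row a H) (- row a H).
Proof. by rewrite /sylvester /block_mx rowKd row_row_mx linearN. Qed.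

Lemma mulmx_sylvester_tr N (H : 'M[R]_N) (u v : 'rV[R]_N) :
  row_mx u v *m (sylvester H)^T =
  row_mx (u *m H^T + v *m H^T) (u *m H^T - v *m H^T).
Proof.
have HN : (- H)^T = - H^T by rewrite linearN.
by rewrite /sylvester tr_block_mx mul_row_block HN mulmxN.
Qed.

Lemma hadamard_sylvester N (H : 'M[R]_N) : (0 < N)%N -> hadamard H ->
  hadamard (sylvester H).
Proof.
move=> N0 [sH HH H0]; split.
- move=> i j; rewrite /sylvester /block_mx !mxE.
  case: fintype.split => i'; rewrite !mxE; case: fintype.split => j' //.
  exact: sign_mxN.
- have HN : (- H)^T = - H^T by rewrite linearN.
  rewrite /sylvester tr_block_mx mulmx_block HN !mulmxN !mulNmx HH opprK.
  by rewrite subrr scalar_mx_block natrD raddfD.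
- move=> i j; rewrite -[i]fintype.splitK; case: fintype.split => i' /= i0; last lia.
  rewrite -[j]fintype.splitK; case: fintype.split => j' /=.
    by rewrite block_mxEul H0.
  by rewrite block_mxEur H0.
Qed.

Lemma growth_link_sylvester_l N (H : 'M[R]_N) (a p : 'I_N) D : growth_link H a p D ->
  growth_link (sylvester H) (lshift N a) (lshift N p) D.
Proof.
case=> pa D0 [g [sg Sg ga gc]]; split=> //; exists (fun s => row_mx (g s) (g s)).
split=> [s||s|s c].
- exact: sign_row_mx.
- rewrite !row_sylvester_l scale_row_mx opp_row_mx add_row_mx -Sg.
  by apply/rowP => j; rewrite -[j]fintype.splitK; case: fintype.split => j' /=;
    rewrite summxE ?row_mxEl ?row_mxEr summxE; apply: eq_bigr => s _;
    rewrite ?row_mxEl ?row_mxEr.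
- by rewrite mulmx_sylvester_tr row_mxEl mxE !ga natrD; lra.
- rewrite mulmx_sylvester_tr -[c]fintype.splitK.
  case: fintype.split => c' /= ac.
    by rewrite row_mxEl mxE !gc ?addr0.
  by rewrite row_mxEr subrr mxE.
Qed.

(** Writing eps for the new sign, the new sign vectors are eps times the function
    equal to [row p H] on one half and to [g s] on the other; exchanging the
    halves doubles the number of vectors, and hence the growth factor. *)
Lemma growth_link_sylvester_r N (H : 'M[R]_N) (a p : 'I_N) D :
  hadamard H -> growth_link H a p D ->
  growth_link (sylvester H) (rshift N a) (rshift N p) (D + D).
Proof.
move=> WH [pa D0 [g [sg Sg ga gc]]].
have sp : sign_mx (row p H) by apply: sign_row; case: WH.
have D0' : D%:R != 0 :> R by rewrite pnatr_eq0 -lt0n.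
split; rewrite ?ltn_add2l ?addn_gt0 ?D0 //.
exists (fun s => match fintype.split s with
  | inl s => row_mx (row p H) (- g s) | inr s => row_mx (g s) (- row p H) end).
split=> [s||s|s c].
- by case: fintype.split => s'; apply: sign_row_mx => //; apply: sign_mxN.
- rewrite big_split_ord /=.
  under eq_bigr => i _ do rewrite (unsplitK (inl i)).
  under [X in _ + X]eq_bigr => i _ do rewrite (unsplitK (inr i)).
  rewrite -big_split /=.
  under eq_bigr => i _ do rewrite add_row_mx -opprD.
  rewrite !row_sylvester_r scale_row_mx opp_row_mx add_row_mx.
  have SE : \sum_i (g i + row p H) = ((D + D)%:R - 1) *: row p H - row a H.
    rewrite big_split /= Sg sumr_const card_ord -[row p H *+ D]scaler_nat natrD.
    by apply/rowP => j; rewrite !mxE; ring.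
  apply/rowP => j; rewrite -[j]fintype.splitK; case: fintype.split => j' /=;
    rewrite summxE ?row_mxEl ?row_mxEr.
    rewrite -SE summxE; apply: eq_bigr => s _; by rewrite row_mxEl addrC.
  rewrite scalerN -opprD -SE [RHS]mxE summxE -sumrN; apply: eq_bigr => s _.
  by rewrite row_mxEr mxE.
- rewrite -[s]fintype.splitK; case: fintype.split => s' /=;
    rewrite ?(unsplitK (inl s')) ?(unsplitK (inr s')) mulmx_sylvester_tr row_mxEr
      !mulNmx !opprK mxE !ga hadamard_dot// -val_eqE /= ltn_eqF// mulr0n !natrD;
    field; rewrite ?D0' -?natrD ?pnatr_eq0 ?addn_eq0 -?lt0n //; lia.
- rewrite -[c]fintype.splitK; case: fintype.split => c' /= ac.
    by have := ltn_ord c'; lia.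
  have ac' : (a < c')%N by lia.
  by case: fintype.split => s';
     rewrite mulmx_sylvester_tr row_mxEr mulNmx opprK mxE gc//
     hadamard_dot// -val_eqE /= ltn_eqF ?addr0 //; lia.
Qed.

(** The value at the first row of the upper half can only be reset: a sign vector
    whose Fourier support consists of that row and of rows of the lower half is
    plus or minus that row.  This relation carries the growth past it, from the
    lower half directly to the second row of the upper half.  Its first sign
    vector agrees with [row p H] where [row a H] is 1 and its second one where
    [row a H] is -1. *)
Lemma growth_link_sylvester_mid N (H : 'M[R]_N) (z a p : 'I_N) : hadamard H ->
  z = 0%N :> nat -> a = 1%N :> nat ->
  growth_link (sylvester H) (rshift N a) (lshift N p) 2.
Proof.
move=> WH z0 a1; have [sH HH H0] := WH.
split=> //=; first by have := ltn_ord p; lia.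
pose f (b : bool) (e : R) : 'rV[R]_N :=
  \row_j (if (H a j == 1) == b then H p j else e).
exists (fun s : 'I_2 => if val s == 0%N then row_mx (f true 1) (f true (-1))
                        else row_mx (f false (-1)) (f false 1)).
have N11 : (-1 == 1 :> R) = false by apply/eqP; lra.
have zE : row z H = const_mx 1 by apply/rowP => j; rewrite !mxE H0.
have d1 : f true 1 - f true (-1) = row z H - row a H.
  apply/rowP => j; rewrite zE !mxE; case: (sH a j) => ->; rewrite ?eqxx ?N11 /=; lra.
have d2 : f false (-1) - f false 1 = - row z H - row a H.
  apply/rowP => j; rewrite zE !mxE; case: (sH a j) => ->; rewrite ?eqxx ?N11 /=; lra.
have sf b e : e = 1 \/ e = -1 -> sign_mx (f b e).
  by move=> se i j; rewrite mxE; case: ifP.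
have dot (c : 'I_N) : (0 < c)%N ->
   (row z H *m H^T) 0 c = 0 /\ (row a H *m H^T) 0 c = N%:R *+ (c == 1%N :> nat).
  move=> c0; rewrite !hadamard_dot// -!val_eqE /= z0 a1 eq_sym gtn_eqF//; split=> //.
  by rewrite eq_sym.
split=> [s||s|s c].
- by case: ifP => _; apply: sign_row_mx; apply: sf; auto.
- rewrite big_ord_recl big_ord1 /= row_sylvester_l row_sylvester_r.
  rewrite scale_row_mx opp_row_mx !add_row_mx; congr row_mx;
  by apply/rowP => j; rewrite !mxE; case: (sH a j) => ->;
     rewrite ?eqxx ?N11 /=; lra.
- have [za aa] := dot a (eq_leq (esym a1)).
  rewrite a1 eqxx mulr1n in aa.
  case: ifP => _;
    rewrite mulmx_sylvester_tr row_mxEr -mulmxBl ?d1 ?d2 mulmxBl ?mulNmx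
    ![(_ - _ : 'rV[R]_N) _ _]mxE ![(- _ : 'rV[R]_N) _ _]mxE za aa natrD; lra.
- rewrite -[c]fintype.splitK; case: fintype.split => c' /= ac.
    by have := ltn_ord c'; lia.
  have [zc acc] : (row z H *m H^T) 0 c' = 0 /\ (row a H *m H^T) 0 c' = 0.
    have [|-> ->] := dot c'; first lia.
    by rewrite gtn_eqF//; lia.
  case: ifP => _;
    rewrite mulmx_sylvester_tr row_mxEr -mulmxBl ?d1 ?d2 mulmxBl ?mulNmx
    ![(_ - _ : 'rV[R]_N) _ _]mxE ![(- _ : 'rV[R]_N) _ _]mxE zc acc; lra.
Qed.

End Hadamard.

(** * Sign systems with rapidly growing solutions *)
Section Growth.
Variable R : realFieldType.

Lemma exists_ge_mean (D : nat) (r : 'I_D -> R) (s : R) : (0 < D)%N ->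
  \sum_i r i = s -> exists i, s / D%:R <= r i.
Proof.
move=> D0 Sr; case: (pickP (fun i => s / D%:R <= r i)) => [i ?|no]; first by exists i.
have: \sum_i r i < \sum_(i < D) s / D%:R.
  apply: ltr_sum; first by apply/hasP; exists (Ordinal D0); rewrite ?mem_index_enum.
  by move=> i _; rewrite ltNge no.
rewrite Sr sumr_const card_ord -[X in _ < X]mulr_natr.
by rewrite divfK ?ltxx// pnatr_eq0 -lt0n.
Qed.

(** Rows are chosen in increasing order.  Adding a multiple of [row a H] to [x]
    changes the value of [row a H] and of the new row but, by orthogonality, of
    no earlier row; invertibility holds because [G *m H^T] is triangular. *)
Lemma growing_system N (H : 'M[R]_N) (P : 'I_N -> 'I_N) (D : 'I_N -> nat) :
  hadamard H -> (forall a : 'I_N, (0 < a)%N -> growth_link H a (P a) (D a)) ->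
  exists (G : 'M[R]_N) (x : 'cV[R]_N),
    [/\ sign_mx G, G \in unitmx,
        forall (i : 'I_N) j, i = 0%N :> nat -> G i j = 1,
        forall a : 'I_N, (G *m x) a 0 = if a == 0%N :> nat then 1 else -1
      & forall a : 'I_N, 0 < (H *m x) a 0 /\
        (if a == 0%N :> nat then (H *m x) a 0 = 1
         else ((D a)%:R - 1) * (H *m x) (P a) 0 + 1 <= (H *m x) a 0)].
Proof.
move=> WH L; have [sH HH H0] := WH.
have [N0|N0] := posnP N.
  exists 1%:M, 0; split; last 1 first.
  - by move=> a; have := ltn_ord a; lia.
  - by move=> a; have := ltn_ord a; lia.
  - exact: unitmx1.
  - by move=> a; have := ltn_ord a; lia.
  - by move=> a; have := ltn_ord a; lia.
have NR : N%:R != 0 :> R by rewrite pnatr_eq0 -lt0n.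
have HHE (a b : 'I_N) : (H *m (row b H)^T) a 0 = N%:R *+ (a == b).
  have := congr1 (fun A : 'M[R]_N => A a b) HH; rewrite !mxE => <-.
  by apply: eq_bigr => j _; rewrite !mxE.
suff /(_ N) [||G [x st]] : forall k, (0 < k)%N -> (k <= N)%N ->
  exists (G : 'I_N -> 'rV[R]_N) (x : 'cV[R]_N), forall a : 'I_N, (a < k)%N ->
    [/\ sign_mx (G a), (G a *m H^T) 0 a != 0 /\
          (forall c : 'I_N, (a < c)%N -> (G a *m H^T) 0 c = 0),
        (a = 0%N :> nat -> G a = const_mx 1),
        (G a *m x) 0 0 = if a == 0%N :> nat then 1 else -1
      & 0 < (H *m x) a 0 /\
        (if a == 0%N :> nat then (H *m x) a 0 = 1
         else ((D a)%:R - 1) * (H *m x) (P a) 0 + 1 <= (H *m x) a 0)] => //.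
  have rG a : row a (\matrix_i G i) = G a by rewrite rowK.
  exists (\matrix_i G i), x; split.
  - by move=> i j; rewrite mxE; case: (st i (ltn_ord i)) => + _ _ _ _; apply.
  - rewrite unitmxE.
    have : \det ((\matrix_i G i) *m H^T) != 0.
      have rr i j : ((\matrix_i G i) *m H^T) i j = (G i *m H^T) 0 j.
        by rewrite -rG -row_mul [RHS]mxE.
      rewrite det_trig; last first.
        apply/is_trig_mxP => i j ij; rewrite rr.
        by case: (st i (ltn_ord i)) => _ [_ +] _ _ _; apply.
      apply/prodf_neq0 => i _; rewrite rr.
      by case: (st i (ltn_ord i)) => _ [+ _] _ _ _.
    by rewrite det_mulmx mulf_eq0 negb_or unitfE => /andP[].
  - move=> i j i0; rewrite mxE.
    by case: (st i (ltn_ord i)) => _ _ /(_ i0) -> _ _; rewrite mxE.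
  - move=> a; case: (st a (ltn_ord a)) => _ _ _ <- _.
    by rewrite -rG -row_mul [RHS]mxE.
  - by move=> a; case: (st a (ltn_ord a)).
elim=> // k IH _ kN; have [k0|k0] := posnP k.
    exists (fun=> const_mx 1), (const_mx N%:R^-1) => a.
  rewrite k0 ltnS leqn0 => /eqP a0.
  have rE : row a H = const_mx 1 by apply/rowP => j; rewrite !mxE H0.
  have sE : \sum_(j < N) N%:R^-1 = 1 :> R.
    by rewrite sumr_const card_ord -[LHS]mulr_natr mulVf.
  have Hx : (H *m const_mx N%:R^-1 : 'cV[R]_N) a 0 = 1.
    by rewrite mxE -[RHS]sE; apply: eq_bigr => j _; rewrite H0// mxE mul1r.
  split; rewrite ?a0 ?eqxx //.
  - by move=> i j; rewrite mxE; left.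
  - split; first by rewrite -rE hadamard_dot// eqxx.
    by move=> c ac; rewrite -rE hadamard_dot// -val_eqE /= a0 ltn_eqF.
  - by rewrite mxE -[RHS]sE; apply: eq_bigr => j _; rewrite !mxE mul1r.
  - by rewrite Hx.
have [G [x st]] := IH k0 (ltnW kN).
pose a := Ordinal kN; have [pa D0 [g [sg Sg ga gc]]] := L a k0.
have DR : (D a)%:R != 0 :> R by rewrite pnatr_eq0 -lt0n.
have [yp _] : 0 < (H *m x) (P a) 0 /\ True.
  by split=> //; case: (st (P a) pa) => _ _ _ _ [].
(* the value of g s on x with its chi_a component removed: unlike (g s *m x) it
   will not change when a multiple of chi_a is added to x *)
pose r s := (g s *m x) 0 0 + (H *m x) a 0 / (D a)%:R.
have [s rs] : exists s, ((D a)%:R - 1) * (H *m x) (P a) 0 / (D a)%:R <= r s.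
  apply: exists_ge_mean => //.
  rewrite big_split /= sumr_const card_ord -[X in _ + X]mulr_natr divfK//.
  have -> : \sum_i (g i *m x) 0 0 = ((\sum_i g i) *m x) 0 0.
    by rewrite mulmx_suml summxE.
  by rewrite Sg mulmxBl -scalemxAl -!row_mul !mxE; ring.
(* the multiple of chi_a that makes the value of g s equal to -1 *)
pose t := ((g s *m x) 0 0 + 1) * (D a)%:R / N%:R.
pose x' := x + t *: (row a H)^T.
have gx' (f : 'rV[R]_N) : (f *m x') 0 0 = (f *m x) 0 0 + t * (f *m H^T) 0 a.
  rewrite mulmxDr -scalemxAr !mxE; congr (_ + _ * _).
  by apply: eq_bigr => j _; rewrite !mxE.
have Hx' b : (H *m x') b 0 = (H *m x) b 0 + t * (N%:R *+ (b == a)).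
  by rewrite mulmxDr -scalemxAr mxE [X in _ + X]mxE HHE.
have Hlow (b : 'I_N) : (b < k)%N -> (H *m x') b 0 = (H *m x) b 0.
  by move=> bk; rewrite Hx' -val_eqE /= ltn_eqF// mulr0n mulr0 addr0.
exists (fun b => if b == a then g s else G b), x' => b; rewrite ltnS leq_eqVlt.
have [-> _|nba /orP[/eqP bk|bk]] := eqVneq b a.
- split=> //; rewrite ?gtn_eqF//.
  + split; last by move=> c; apply: gc.
    by rewrite ga oppr_eq0 mulf_neq0// invr_neq0.
  + by move=> /= a0; move: k0; rewrite a0.
  + by rewrite gx' ga /t; field; rewrite DR NR.
  + rewrite Hx' eqxx mulr1n Hlow//.
    have -> : (H *m x) a 0 + t * N%:R = (D a)%:R * r s + (D a)%:R.
      by rewrite /t /r; field; rewrite DR NR.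
    have D1 : 1 <= (D a)%:R :> R by rewrite ler1n.
    move: rs; rewrite ler_pdivrMr ?ltr0n// => rs.
    have : 0 <= ((D a)%:R - 1) * (H *m x) (P a) 0.
      by apply: mulr_ge0; [lra | exact: ltW].
    by split; nra.
- by case/eqP: nba; apply: val_inj.
have [s1 [s2 s3] s4 s5 s6] := st b bk.
split=> //.
- by rewrite gx' s3 ?mulr0 ?addr0.
- rewrite Hlow//; move: s6; case: eqP => // b0 [y0 yb]; split=> //.
  have b1 : (0 < b)%N by rewrite lt0n; apply/eqP.
  by have [pb _ _] := L b b1; rewrite Hlow// (ltn_trans pb bk).
Qed.

End Growth.

(** * Growth achieved by Sylvester matrices *)
Section Levels.
Variable R : realFieldType.

(** These links pass from one doubling to the next; the growth in the upper half
    of a doubling comes from those of the lower half. *)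
Definition successor_links N (H : 'M[R]_N) (d : nat -> nat) : Prop :=
  forall a p : 'I_N, a = p.+1 :> nat -> growth_link H a p (d a).

(** The links actually used for a matrix, with the bound that they imply for
    the last value; [P] need not give the immediate predecessor, so that rows at
    which the value is reset can be skipped. *)
Definition forces_growth N (H : 'M[R]_N) (K : R) : Prop :=
  exists (P : 'I_N -> 'I_N) (D : 'I_N -> nat),
    (forall a : 'I_N, (0 < a)%N -> growth_link H a (P a) (D a)) /\
    forall y : 'I_N -> R, (forall a, 0 < y a) ->
      (forall a : 'I_N, (0 < a)%N -> ((D a)%:R - 1) * y (P a) + 1 <= y a) ->
      forall l : 'I_N, l.+1 = N -> K <= y l.

Definition sylvester_mult N (d : nat -> nat) (a : nat) : nat :=
  if (a < N)%N then d a else if a == N then 1%N else (d (a - N)%N + d (a - N)%N)%N.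

Lemma successor_links_sylvester N (H : 'M[R]_N) d : hadamard H ->
  successor_links H d -> successor_links (sylvester H) (sylvester_mult N d).
Proof.
move=> WH L a p; rewrite -[a]fintype.splitK -[p]fintype.splitK.
case: fintype.split => a'; case: fintype.split => p' /=; rewrite /sylvester_mult.
- by move=> ap; rewrite ltn_ord; apply/growth_link_sylvester_l/L.
- by have := ltn_ord a'; lia.
- have := ltn_ord a'; have := ltn_ord p' => *.
  have -> : (N + a' < N)%N = false by lia.
  have a0 : a' = 0%N :> nat by lia.
  have -> : (N + a' == N)%N by lia.
  apply: growth_link_trivial => //=; last lia.
  by apply: hadamard_sylvester => //; lia.
- move=> ap; have ap' : a' = p'.+1 :> nat by lia.
  have -> : (N + a' < N)%N = false by lia.
  have -> : (N + a' == N)%N = false by lia.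
  rewrite addKn; apply: growth_link_sylvester_r => //; exact: L.
Qed.

(** The lower half contributes its own growth [K]; the upper half, reached
    through [growth_link_sylvester_mid], multiplies it by all the doubled factors
    [2 * d a - 1], each of which is at least [d a]. *)
Lemma forces_growth_sylvester N (H : 'M[R]_N) d (K : R) : (1 < N)%N -> hadamard H ->
  0 <= K -> successor_links H d -> forces_growth H K ->
  forces_growth (sylvester H) ((\prod_(2 <= a < N) d a)%N%:R * K).
Proof.
move=> N1 WH K0 L [P [D [PD GR]]].
have N0 : (0 < N)%N by lia.
have lN : (N.-1 < N)%N by lia.
pose l := Ordinal lN; pose z := Ordinal N0; pose o := Ordinal N1.
have prN (a : 'I_N) : (a.-1 < N)%N by have := ltn_ord a; lia.
exists (fun a => match fintype.split a with
  | inl a => lshift N (P a)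
  | inr a => if a == z then lshift N l else if a == o then lshift N l
             else rshift N (Ordinal (prN a)) end).
exists (fun a => match fintype.split a with
  | inl a => D a
  | inr a => if a == z then 1%N else if a == o then 2
             else (d a + d a)%N end).
split=> [a|y y0 yg l' l'N].
  rewrite -[a]fintype.splitK; case: fintype.split => a' /= a0.
    by rewrite (unsplitK (inl a')); apply/growth_link_sylvester_l/PD.
  rewrite (unsplitK (inr a')).
  have [az|az] := eqVneq a' z.
    by apply: growth_link_trivial => /=; [exact: hadamard_sylvester | lia].
  have [->|ao] := eqVneq a' o; first exact: (@growth_link_sylvester_mid _ _ _ z).
  apply: growth_link_sylvester_r => //; apply: L => /=.
  by rewrite prednK// lt0n; apply: contra_neq az => ?; apply: val_inj.
have yl : K <= y (lshift N l).
  apply: (GR (fun a => y (lshift N a))) => //=; last lia.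
  by move=> a a0; have := yg (lshift N a) a0; rewrite (unsplitK (inl a)).
have yr i (iN : (i < N)%N) : (0 < i)%N ->
    (\prod_(2 <= a < i.+1) d a)%N%:R * K <= y (rshift N (Ordinal iN)).
  elim: i iN => // i IH iN _; have [i0|i0] := posnP i.
    subst i; rewrite big_geq// mul1r; apply: le_trans yl _.
    have := yg (rshift N (Ordinal iN)); rewrite (unsplitK (inr (Ordinal iN))) /=.
    rewrite addn_gt0 N0 -?val_eqE /= => /(_ isT).
    have := y0 (lshift N l); lra.
  have iN' : (i < N)%N by lia.
  have := yg (rshift N (Ordinal iN)); rewrite (unsplitK (inr (Ordinal iN))) /=.
  rewrite addn_gt0 N0 -?val_eqE /= => /(_ isT).
  have -> : (i.+1 == 1)%N = false by lia.
  have -> : Ordinal (prN (Ordinal iN)) = Ordinal iN' by apply: val_inj.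
  rewrite big_nat_recr //=.
  have := IH iN' i0; have := y0 (rshift N (Ordinal iN')).
  have [_ + _] : growth_link H (Ordinal iN) (Ordinal iN') (d i.+1) by apply: L.
  rewrite -(ler1n R) natrM natrD => q1 u0 pu uw.
  have : (d i.+1)%:R * ((\prod_(2 <= a < i.+1) d a)%N%:R * K)
     <= (d i.+1)%:R * y (rshift N (Ordinal iN')).
    by rewrite ler_wpM2l//; lra.
  nra.
have -> : l' = rshift N l by apply: val_inj => /=; lia.
by have := yr N.-1 lN; rewrite prednK //; apply; lia.
Qed.

Definition hadamard2 : 'M[R]_2 := \matrix_(i, j) (-1) ^+ (i * j).

Lemma hadamard_hadamard2 : hadamard hadamard2.
Proof.
split.
- move=> i j; rewrite mxE -signr_odd; case: odd; by [right | left].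
- apply/matrixP => i j; rewrite !mxE !big_ord_recl big_ord0 !mxE /=.
  by case: i j => [[|[|?]] ?] [[|[|?]] ?] //=; rewrite -?val_eqE /=; lra.
- by move=> i j i0; rewrite mxE i0 mul0n.
Qed.

(** Doubling squares the product of the [d a] and multiplies it by 2^(N-1), so
    its logarithm e satisfies e' = 2 e + N - 1, while the logarithm g of the
    growth satisfies g' = g + e.  Both recursions have solutions
    (m/2) 2^m - O(2^m); the stated inequalities are forms of this that survive
    the induction. *)
Lemma hadamard_level m : exists (N : nat) (H : 'M[R]_N) (d : nat -> nat) (e g : nat),
  [/\ N = (2 ^ m.+1)%N, hadamard H,
      successor_links H d /\ (2 ^ e <= \prod_(2 <= a < N) d a)%N,
      forces_growth H (2 ^+ g)
    & (m.+1 * N + 2 <= 2 * e + 2 * N)%N /\ (m.+1 * N <= 2 * g + 4 * N)%N].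
Proof.
elim: m => [|m [N [H [d [e [g [NE WH [L Pd] F [be bg]]]]]]]].
  have L (a p : 'I_2) : a = p.+1 :> nat -> growth_link hadamard2 a p 1.
    by move=> ap; apply: growth_link_trivial; [exact: hadamard_hadamard2 | lia].
  exists 2, hadamard2, (fun=> 1%N), 0%N, 0%N; split=> //.
  - exact: hadamard_hadamard2.
  - by split=> //; rewrite big_geq.
  - exists (fun=> 0), (fun=> 1%N); split=> [a a0|y _ yg l lN].
      by apply: growth_link_trivial; [exact: hadamard_hadamard2 | exact: a0].
    by have := yg l; rewrite subrr mul0r add0r expr0; apply; lia.
have N1 : (1 < N)%N by rewrite NE expnS; have := expn_gt0 2 m; lia.
exists (N + N)%N, (sylvester H), (sylvester_mult N d), (e + e + N.-1)%N, (e + g)%N.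
split.
- by rewrite expnS NE; lia.
- by apply: hadamard_sylvester => //; lia.
- split; first exact: successor_links_sylvester.
  rewrite (big_cat_nat _ (n := N)) /=; [|lia|lia].
  rewrite (big_cat_nat _ (m := N) (n := N.+1)) /=; [|lia|lia].
  rewrite big_nat1 /sylvester_mult ltnn eqxx mul1n.
  have -> : (\prod_(2 <= a < N) (if a < N then d a else if a == N then 1
      else d (a - N) + d (a - N)) = \prod_(2 <= a < N) d a)%N.
    by apply: eq_big_nat => a /andP[_ ->].
  rewrite -(add1n N) big_addn.
  have -> : (N + N - N = N)%N by lia.
  have -> : (\prod_(1 <= i < N) (if i + N < N then d (i + N) else
       if i + N == N then 1 else d (i + N - N) + d (i + N - N))
      = \prod_(1 <= a < N) (2 * d a))%N.
    apply: eq_big_nat => a aN; rewrite addnK.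
    by have [-> ->] : (a + N < N)%N = false /\ (a + N == N)%N = false; lia.
  rewrite big_split /= prod_nat_const_nat -addnA expnD subn1.
  rewrite leq_mul// addnC expnD leq_mul//.
  rewrite big_ltn//; apply: leq_trans Pd _; rewrite leq_pmull//.
  have N0 : (0 < N)%N by lia.
  by have [] := L (Ordinal N1) (Ordinal N0) erefl.
- have K0 : 0 <= 2 ^+ g :> R by apply: exprn_ge0.
  have [P [D [PD GR]]] := forces_growth_sylvester N1 WH K0 L F.
  exists P, D; split=> // y y0 yg l lN; apply: le_trans (GR y y0 yg l lN).
  by rewrite exprD ler_wpM2r// -natrX ler_nat.
- by split; nia.
Qed.

End Levels.

(** * Invertible 0/1 matrices whose inverse has a large entry *)
Section Amplifiers.
Variable R : realFieldType.

Definition zero_one m n (A : 'M[R]_(m, n)) : Prop :=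
  forall i j, A i j = 0 \/ A i j = 1.

Definition solves_unit n (Z : 'M[R]_n) (v : 'cV[R]_n) (r : 'I_n) : Prop :=
  [/\ zero_one Z, Z \in unitmx & Z *m v = delta_mx r 0].

Definition amplifier n (X : R) : Prop :=
  exists (Z : 'M[R]_n) (v : 'cV[R]_n) (r i : 'I_n),
    solves_unit Z v r /\ X <= `|v i 0|.

Lemma zero_one_delta m n i0 j0 : zero_one (delta_mx i0 j0 : 'M[R]_(m, n)).
Proof. by move=> i j; rewrite mxE; case: (_ && _); [right | left]. Qed.

Lemma zero_one_block m1 m2 n1 n2 (A : 'M[R]_(m1, n1)) (B : 'M[R]_(m1, n2))
    (C : 'M[R]_(m2, n1)) (D : 'M[R]_(m2, n2)) :
  zero_one A -> zero_one B -> zero_one C -> zero_one D ->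
  zero_one (block_mx A B C D).
Proof.
by move=> zA zB zC zD i j; rewrite /block_mx mxE; case: fintype.split => i';
   rewrite mxE; case: fintype.split.
Qed.

Lemma solves_unit1 n (r : 'I_n) : solves_unit (1%:M : 'M[R]_n) (delta_mx r 0) r.
Proof.
split; [|exact: unitmx1 | exact: mul1mx].
by move=> i j; rewrite mxE; case: (_ == _); [right | left].
Qed.

Lemma amplifier_id n : (0 < n)%N -> amplifier n 1.
Proof.
case: n => // n _; exists 1%:M, (delta_mx ord0 0), ord0, ord0.
by split; [exact: solves_unit1 | rewrite mxE !eqxx normr1].
Qed.

(** The extra coefficient 1 feeds the entry [i1] of the first solution into the
    right-hand side of the second system, so that the amplifications multiply
    while the orders add. *)
Lemma solves_unit_glue n1 n2 (Z1 : 'M[R]_n1) v1 r1 (i1 : 'I_n1)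
    (Z2 : 'M[R]_n2) v2 r2 :
  solves_unit Z1 v1 r1 -> solves_unit Z2 v2 r2 ->
  solves_unit (block_mx Z1 0 (delta_mx r2 i1) Z2)
    (col_mx v1 (- v1 i1 0 *: v2)) (lshift n2 r1).
Proof.
move=> [z1 u1 e1] [z2 u2 e2]; split.
- apply: zero_one_block => //; last exact: zero_one_delta.
  by move=> i j; rewrite mxE; left.
- move: u1 u2; rewrite !unitmxE det_lblock !unitfE mulf_eq0 negb_or.
  by move=> -> ->.
- rewrite mul_block_col mul0mx addr0 e1 -scalemxAr e2.
  have -> : delta_mx r2 i1 *m v1 = v1 i1 0 *: (delta_mx r2 0 : 'cV[R]_n2).
    apply/colP => j; rewrite !mxE (bigD1 i1)//= big1 => [|k ki].
      by rewrite !mxE !eqxx !andbT addr0 mulrC.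
    by rewrite !mxE (negbTE ki) andbF mul0r.
  rewrite -scalerDl subrr scale0r; apply/colP => j.
  rewrite -[j]fintype.splitK; case: fintype.split => j' /=;
    rewrite ?col_mxEu ?col_mxEd !mxE.
    by rewrite -!val_eqE.
  by rewrite -val_eqE /= gtn_eqF//; have := ltn_ord r1; lia.
Qed.

Lemma amplifierM n1 n2 X1 X2 : 0 <= X1 -> 0 <= X2 ->
  amplifier n1 X1 -> amplifier n2 X2 -> amplifier (n1 + n2) (X1 * X2).
Proof.
move=> X10 X20 [Z1 [v1 [r1 [i1 [S1 l1]]]]] [Z2 [v2 [r2 [i2 [S2 l2]]]]].
exists (block_mx Z1 0 (delta_mx r2 i1) Z2), (col_mx v1 (- v1 i1 0 *: v2)),
  (lshift n2 r1), (rshift n1 i2); split; first exact: (solves_unit_glue i1 S1 S2).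
by rewrite (col_mxEd _ _ i2) mxE normrM normrN ler_pM.
Qed.

Lemma amplifier_le n (X Y : R) : X <= Y -> amplifier n Y -> amplifier n X.
Proof.
by move=> XY [Z [v [r [i [S le]]]]]; exists Z, v, r, i; split=> //; apply: le_trans le.
Qed.

Lemma amplifier_exp n X k : (0 < n)%N -> 0 <= X -> amplifier n X ->
  forall q, (0 < q)%N -> q = (k * n)%N -> amplifier q (X ^+ k).
Proof.
move=> n0 X0 An; elim: k => [|k IH] q q0 qE; first lia.
have [k0|k0] := posnP k; first by rewrite qE k0 mul1n expr1.
rewrite qE mulSn exprS; apply: amplifierM => //; first exact: exprn_ge0.
by apply: IH => //; rewrite muln_gt0 k0.
Qed.

(** From +-1 to 0/1: since the first equation says that the entries of [x] sum
    to 1, replacing each other row g by (1 - g) / 2 turns the right-hand side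
    -1 into 1.  All equations then read [P *m x = 1], and one more unknown, equal
    to 1, makes them homogeneous up to a unit vector. *)
Lemma amplifier_sign_mx N (G : 'M[R]_N) (x : 'cV[R]_N) (h : 'rV[R]_N) (K : R) :
  (0 < N)%N -> sign_mx G -> G \in unitmx ->
  (forall (i : 'I_N) j, i = 0%N :> nat -> G i j = 1) ->
  (forall a : 'I_N, (G *m x) a 0 = if a == 0%N :> nat then 1 else -1) ->
  sign_mx h -> K <= (h *m x) 0 0 -> amplifier (N + 1) (K / N%:R).
Proof.
move=> N0 sG uG G0 Gx sh Kh.
have [i Xi] : exists i, K / N%:R <= `|x i 0|.
  have [i li] := @exists_ge_mean R N (fun i => `|x i 0|) _ N0 erefl.
  exists i; apply: le_trans li; rewrite ler_wpM2r ?invr_ge0 ?ler0n//.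
  apply: le_trans Kh _; rewrite mxE; apply: ler_sum => j _.
  by case: (sh 0 j) => ->; rewrite ?mul1r ?mulN1r ?ler_norm// -normrN ler_norm.
pose P : 'M[R]_N := \matrix_(i, j) if i == 0%N :> nat then 1 else (1 - G i j) / 2.
have PE (w : 'cV[R]_N) i' : (P *m w) i' 0 =
    if i' == 0%N :> nat then \sum_j w j 0 else (\sum_j w j 0 - (G *m w) i' 0) / 2.
  rewrite !mxE; case: ifP => i0.
    by apply: eq_bigr => j _; rewrite mxE i0 mul1r.
  rewrite -sumrB mulr_suml; apply: eq_bigr => j _; rewrite mxE i0; lra.
have G0E (w : 'cV[R]_N) (i' : 'I_N) : i' == 0%N :> nat -> (G *m w) i' 0 = \sum_j w j 0.
  by move/eqP => i0; rewrite mxE; apply: eq_bigr => j _; rewrite G0// mul1r.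
have zP : zero_one P.
  move=> k j; rewrite mxE; case: ifP => _; first by right.
  by case: (sG k j) => ->; [left | right]; lra.
have uP : P \in unitmx.
  rewrite -unitmx_tr -row_free_unit; apply: inj_row_free => w wP.
  have Pw : P *m w^T = 0 by rewrite -[P]trmxK -trmx_mul wP trmx0.
  have sw : \sum_j w^T j 0 = 0.
    by have := PE w^T (Ordinal N0); rewrite Pw mxE.
  have Gw : G *m w^T = 0.
    apply/colP => k; rewrite [RHS]mxE; case: (boolP (k == 0%N :> nat)) => k0.
      by rewrite G0E.
    by have := PE w^T k; rewrite Pw mxE (negbTE k0) sw; lra.
  by apply: trmx_inj; rewrite trmx0 -(mulKmx uG w^T) Gw mulmx0.
have Px : P *m x = const_mx 1.
  have sx : \sum_j x j 0 = 1 by rewrite -(G0E x (Ordinal N0))// Gx.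
  by apply/colP => k; rewrite PE sx Gx mxE; case: eqP => // _; lra.
exists (block_mx P (const_mx 1) 0 1%:M), (col_mx (- x) 1%:M).
exists (rshift N 0), (lshift 1 i).
split; last by rewrite col_mxEu mxE normrN.
split.
- apply: zero_one_block => //; move=> k j; rewrite mxE; [by right| by left|].
  by case: (_ == _); [right | left].
- by rewrite unitmxE det_ublock det1 mulr1 -unitmxE.
- rewrite mul_block_col mulmxN Px mulmx1 mul0mx add0r mulmx1 addNr.
  apply/colP => j; rewrite -[j]fintype.splitK; case: fintype.split => j' /=.
    by rewrite col_mxEu !mxE -val_eqE /= ltn_eqF// ltn_addr.
  by rewrite col_mxEd !mxE (ord1 j') !eqxx.
Qed.

(** Dividing by N in [amplifier_sign_mx] costs [m] in the exponent; the
    constant 8 leaves room for this and for the O(2^m) losses, and makes the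
    claim trivial for small [m]. *)
Lemma amplifier_block m : exists e : nat,
  ((m - 8) * (2 ^ m + 1) <= 2 * e)%N /\ amplifier (2 ^ m + 1) (2 ^+ e).
Proof.
have [m8|m8] := leqP m 8.
  by exists 0%N; split; [rewrite (eqP m8) | apply: amplifier_id; rewrite addn1].
case: m m8 => // m m8.
have [N [H [d [e [g [NE WH _ [P [D [PD GR]]] [_ bg]]]]]]] := hadamard_level R m.
have N0 : (0 < N)%N by rewrite NE expn_gt0.
have lN : (N.-1 < N)%N by lia.
have [G [x [sG uG G0 Gx yx]]] := growing_system WH PD.
have Kl : 2 ^+ g <= (H *m x) (Ordinal lN) 0.
  apply: (GR (fun a => (H *m x) a 0)) => /=; last lia.
    by move=> a; case: (yx a).
  by move=> a a0; case: (yx a) => _; rewrite gtn_eqF.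
have sH : sign_mx (row (Ordinal lN) H) by apply: sign_row; case: WH.
have Kh : 2 ^+ g <= (row (Ordinal lN) H *m x) 0 0 by rewrite -row_mul mxE.
have := amplifier_sign_mx N0 sG uG G0 Gx sH Kh; rewrite {1}NE => A.
have mN : (m.+1 <= N)%N by rewrite NE ltnW// ltn_expl.
exists (g - m.+1)%N; split; first by rewrite -NE; nia.
apply: amplifier_le A; rewrite ler_pdivlMr ?ltr0n// NE natrX -exprD.
by rewrite subnK//; nia.
Qed.

Lemma large_amplifier n m : (0 < n)%N -> exists e : nat,
  ((m - 8) * (n - (2 ^ m + 1)) <= 2 * e)%N /\ amplifier n (2 ^+ e).
Proof.
move=> n0; set s := (2 ^ m + 1)%N; have s0 : (0 < s)%N by rewrite /s addn1.
have [e [be Ae]] := amplifier_block m; rewrite -/s in be Ae.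
have [q0|q0] := posnP (n.-1 %/ s).
  exists 0%N; split; last exact: amplifier_id.
  have : (n <= s)%N.
    have := divn_eq n.-1 s; rewrite q0 mul0n add0n; have := ltn_pmod n.-1 s0; lia.
  by rewrite -subn_eq0 => /eqP ->; rewrite muln0.
exists (n.-1 %/ s * e)%N; split.
  have := divn_eq n.-1 s; have := ltn_pmod n.-1 s0.
  set q := (_ %/ _)%N; set w := (_ %% _)%N => ws nE.
  have : (n - s <= q * s)%N by lia.
  nia.
have Aq : amplifier (n.-1 %/ s * s) (2 ^+ e ^+ (n.-1 %/ s)).
  by apply: (amplifier_exp s0 _ Ae) => //; rewrite ?exprn_ge0 ?muln_gt0 ?q0.
have Ar : amplifier (n.-1 %% s).+1 1 by apply: amplifier_id.
have X0 : 0 <= 2 ^+ e ^+ (n.-1 %/ s) :> R by rewrite !exprn_ge0.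
have := amplifierM X0 ler01 Aq Ar.
by rewrite addnS -divn_eq prednK// mulr1 -exprM mulnC.
Qed.

End Amplifiers.

(** * Integer matrices as real matrices *)
Section RealMx.
Variable R : realType.

Lemma real_mxD m n (A B : 'M[int]_(m, n)) :
  real_mx R (A + B) = real_mx R A + real_mx R B.
Proof. by apply/matrixP => i j; rewrite !mxE intrD. Qed.

Lemma real_mxN m n (A : 'M[int]_(m, n)) : real_mx R (- A) = - real_mx R A.
Proof. by apply/matrixP => i j; rewrite !mxE intrN. Qed.

Lemma real_mxB m n (A B : 'M[int]_(m, n)) :
  real_mx R (A - B) = real_mx R A - real_mx R B.
Proof. by rewrite real_mxD real_mxN. Qed.

Lemma real_mx0 m n : real_mx R (0 : 'M[int]_(m, n)) = 0.
Proof. by apply/matrixP => i j; rewrite !mxE. Qed.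

Lemma real_mxMn m n (A : 'M[int]_(m, n)) k : real_mx R (A *+ k) = real_mx R A *+ k.
Proof. by elim: k => [|k IH]; rewrite ?real_mx0// !mulrS real_mxD IH. Qed.

Lemma real_mx_sum m n (I : Type) (r : seq I) (P : pred I) (F : I -> 'M[int]_(m, n)) :
  real_mx R (\sum_(i <- r | P i) F i) = \sum_(i <- r | P i) real_mx R (F i).
Proof. exact: (big_morph _ (@real_mxD m n) (@real_mx0 m n)). Qed.

Lemma real_mxM m n p (A : 'M[int]_(m, n)) (B : 'M[int]_(n, p)) :
  real_mx R (A *m B) = real_mx R A *m real_mx R B.
Proof.
apply/matrixP => i j; rewrite !mxE rmorph_sum; apply: eq_bigr => k _.
by rewrite !mxE /= -intrM.
Qed.

Lemma real_mx_row m n (A : 'M[int]_(m, n)) i :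
  real_mx R (row i A) = row i (real_mx R A).
Proof. by apply/matrixP => a b; rewrite !mxE. Qed.

Lemma real_mx_inj m n : injective (@real_mx R m n).
Proof.
move=> A B AB; apply/matrixP => i j.
by have := congr1 (fun M : 'M[R]_(m, n) => M i j) AB; rewrite !mxE => /intr_inj.
Qed.

Lemma mulmx_row_sum p n (y : 'rV[R]_p) (A : 'M[int]_(p, n)) :
  y *m real_mx R A = \sum_i y 0 i *: real_mx R (row i A).
Proof. by rewrite mulmx_sum_row; apply: eq_bigr => i _; rewrite real_mx_row. Qed.

End RealMx.

(** * Minimal Hilbert bases *)
Section NatSpan.
Variables (R : realType) (n : nat).
Implicit Types (H : {fset 'rV[int]_n}) (v h : 'rV[int]_n).

Definition nat_span H : set 'rV[int]_n :=
  [set v | exists c : 'rV[int]_n -> nat, v = \sum_(h <- H) h *+ c h].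

Lemma nat_span0 H : nat_span H 0.
Proof. by exists (fun=> 0%N); rewrite big1// => h _; rewrite mulr0n. Qed.

Lemma nat_spanD H v w : nat_span H v -> nat_span H w -> nat_span H (v + w).
Proof.
move=> [c ->] [d ->]; exists (fun h => c h + d h)%N.
by rewrite -big_split; apply: eq_bigr => h _; rewrite mulrnDr.
Qed.

Lemma nat_spanMn H v k : nat_span H v -> nat_span H (v *+ k).
Proof.
move=> Hv; elim: k => [|k IH]; first exact: nat_span0.
by rewrite mulrS; apply: nat_spanD.
Qed.

Lemma nat_span_sum H (I : eqType) (r : seq I) (F : I -> 'rV[int]_n) :
  (forall i, i \in r -> nat_span H (F i)) -> nat_span H (\sum_(i <- r) F i).
Proof.
move=> HF; rewrite big_seq; elim/big_ind: _ => //; first exact: nat_span0.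
exact: nat_spanD.
Qed.

Lemma nat_span_gen H h : h \in H -> nat_span H h.
Proof.
move=> hH; exists (fun g => (g == h)%N).
rewrite (big_fsetD1 h)//= eqxx big_seq big1 ?addr0// => g.
by rewrite !inE => /andP[/negbTE -> _].
Qed.

Lemma nat_span_trans H H' : {subset H <= nat_span H'} -> nat_span H `<=` nat_span H'.
Proof.
move=> HH v [c ->]; apply: nat_span_sum => h /HH hH; apply: nat_spanMn.
by rewrite inE in hH.
Qed.

(** Either [h] occurs in an expression of [v] and can be subtracted, or it can
    be left out of the generators. *)
Lemma nat_spanB_or_D1 H v h : h \in H -> nat_span H v ->
  nat_span (H `\ h)%fset v \/ nat_span H (v - h).
Proof.
move=> hH [c ->]; have [c0|c0] := posnP (c h).
  by left; exists c; rewrite (big_fsetD1 h)//= c0 mulr0n add0r.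
right; rewrite (big_fsetD1 h)//= addrAC.
have -> : h *+ c h - h = h *+ (c h).-1.
  by rewrite -{1}(prednK c0) mulrSr addrK.
apply: nat_spanD; first exact/nat_spanMn/nat_span_gen.
apply: nat_span_sum => g; rewrite !inE => /andP[_ gH].
exact/nat_spanMn/nat_span_gen.
Qed.

End NatSpan.

Section HilbertBases.
Variables (R : realType) (n : nat).
Implicit Types (B : 'M[int]_n) (H : {fset 'rV[int]_n}) (v h : 'rV[int]_n).

Lemma cone_of_row B i : cone_of R B (real_mx R (row i B)).
Proof.
exists (delta_mx 0 i); split; first by move=> j; rewrite mxE; case: (_ && _).
by rewrite -rowE real_mx_row.
Qed.

Lemma cone_of0 B : cone_of R B 0.
Proof. by exists 0; split; [move=> i; rewrite mxE | rewrite mul0mx]. Qed.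

Lemma cone_ofD B x y : cone_of R B x -> cone_of R B y -> cone_of R B (x + y).
Proof.
move=> [c [c0 ->]] [d [d0 ->]]; exists (c + d); rewrite mulmxDl; split=> // i.
by rewrite mxE addr_ge0.
Qed.

Lemma cone_of_nat_span B H v : (forall h, h \in H -> cone_of R B (real_mx R h)) ->
  nat_span H v -> cone_of R B (real_mx R v).
Proof.
move=> HC [c ->]; rewrite real_mx_sum big_seq.
elim/big_ind: _ => [||h hH]; [exact: cone_of0 | exact: cone_ofD|].
rewrite real_mxMn; elim: (c h) => [|k IH]; first exact: cone_of0.
by rewrite mulrS; apply: cone_ofD => //; apply: HC.
Qed.

(** If the coefficient of [h] at the generator b = [row i B] exceeds 1, then
    [h] = b + ([h] - b) with both terms in the cone.  Neither term uses [h] in its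
    expression, because subtracting [h] would give -([h] - b) or -b, which are
    outside the cone by independence of the generators.  So [h] is redundant. *)
Lemma min_hilbert_basis_le1 B H h : row_free (real_mx R B) ->
  min_hilbert_basis (cone_of R B) H -> h \in H ->
  exists2 c : 'rV[R]_n, forall i, 0 <= c 0 i <= 1 & real_mx R h = c *m real_mx R B.
Proof.
move=> fB [[HC HS] Hmin] hH; have [c [c0 hc]] := HC h hH.
exists c => // i; rewrite c0 /= leNgt; apply/negP => c1.
pose e : 'rV[R]_n := delta_mx 0 i.
have be : real_mx R (row i B) = e *m real_mx R B by rewrite -rowE real_mx_row.
have hb : cone_of R B (real_mx R (h - row i B)).
  exists (c - e); rewrite real_mxB hc be mulmxBl; split=> // j.
  rewrite !mxE eqxx /=; case: eqP => [->|_]; last by rewrite subr0.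
  by rewrite subr_ge0 ltW.
have no_neg (d : 'rV[R]_n) v : 0 < d 0 i -> real_mx R v = d *m real_mx R B ->
    ~ cone_of R B (real_mx R (- v)).
  move=> di vd [d' [d'0]]; rewrite real_mxN vd -mulNmx => /(row_free_inj fB).
  by move=> /(congr1 (fun M : 'rV_n => M 0 i)); rewrite mxE; have := d'0 i; lra.
have Sb : nat_span (H `\ h)%fset (row i B).
  have [//|] := nat_spanB_or_D1 hH (HS _ (cone_of_row B i)).
  move/(cone_of_nat_span HC); rewrite -opprB => /(no_neg (c - e)) []; last first.
    by rewrite real_mxB hc be mulmxBl.
  by rewrite !mxE !eqxx /= subr_gt0.
have Sh : nat_span (H `\ h)%fset (h - row i B).
  have [//|] := nat_spanB_or_D1 hH (HS _ hb).
  rewrite addrAC subrr add0r => /(cone_of_nat_span HC) /(no_neg e) [] //.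
  by rewrite mxE !eqxx.
have /Hmin : hilbert_basis (cone_of R B) (H `\ h)%fset.
  split=> [g|v /HS]; first by rewrite !inE => /andP[_ /HC].
  apply: nat_span_trans => g gH; rewrite inE.
  have [->|gh] := eqVneq g h; last by apply: nat_span_gen; rewrite !inE gh.
  by rewrite -[X in nat_span _ X](subrK (row i B)); apply: nat_spanD.
by move=> /(_ (fsubD1set _ _)) E; move: hH; rewrite -E !inE eqxx.
Qed.

Definition entries_le m1 m2 (A : 'M[int]_(m1, m2)) (K : nat) : Prop :=
  forall i j, (`|A i j| <= K)%N.

Lemma entries_le_comb B K (c : 'rV[R]_n) h : entries_le B K ->
  (forall i, 0 <= c 0 i <= 1) -> real_mx R h = c *m real_mx R B ->
  entries_le h (n * K).
Proof.
move=> BK c01 hc i j; rewrite (ord1 i) -(ler_nat R) natr_absz intr_norm.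
have -> : (h 0 j)%:~R = \sum_k c 0 k * (B k j)%:~R :> R.
  have := congr1 (fun M : 'rV_n => M 0 j) hc; rewrite !mxE => ->.
  by apply: eq_bigr => k _; rewrite mxE.
apply: le_trans (ler_norm_sum _ _ _) _.
have -> : (n * K)%:R = \sum_(k < n) K%:R :> R.
  by rewrite sumr_const card_ord -[RHS]mulr_natr -natrM mulnC.
apply: ler_sum => k _; rewrite normrM -intr_norm -natr_absz.
have /andP[k0 k1] := c01 k; rewrite ger0_norm// -[leRHS]mul1r ler_pM ?ler0n//.
by rewrite ler_nat BK.
Qed.

Definition bounded_rows (K : nat) : {fset 'rV[int]_n} :=
  [fset map_mx (fun i : 'I_(K + K).+1 => i%:Z - K%:Z) u
     | u in 'rV['I_(K + K).+1]_n]%fset.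

Lemma bounded_rowsP K v : entries_le v K -> v \in bounded_rows K.
Proof.
move=> vK; apply/imfsetP; exists (\row_j inord `|v 0 j + K%:Z|) => //=.
apply/rowP => j; rewrite !mxE inordK; have := vK 0 j; lia.
Qed.

Lemma entries_le_exists B : exists K, entries_le B K.
Proof.
exists (\sum_i \sum_j `|B i j|)%N => i j.
by rewrite (bigD1 i)//= (bigD1 j)//= -addnA leq_addr.
Qed.

(** Gordan's argument: rounding down the coefficients of an integer point of the
    cone leaves an integer point with coefficients in [0, 1], and such points
    have bounded entries. *)
Lemma hilbert_basis_exists B : exists H, hilbert_basis (cone_of R B) H.
Proof.
have [K BK] := entries_le_exists B.
exists [fset h in bounded_rows (n * K) | `[< cone_of R B (real_mx R h) >]]%fset.
set H := [fset h in _ | _]%fset; split=> [h|v [c [c0 vc]]].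
  by rewrite !inE => /andP[_ /asboolP].
have HH (d : 'rV[R]_n) h : (forall i, 0 <= d 0 i <= 1) ->
    real_mx R h = d *m real_mx R B -> nat_span H h.
  move=> d01 hd; apply: nat_span_gen; rewrite !inE bounded_rowsP /=.
    by apply/asboolP; exists d; split=> // i; case/andP: (d01 i).
  exact: entries_le_comb d01 hd.
have Hb i : nat_span H (row i B).
  apply: (HH (delta_mx 0 i)); last by rewrite -rowE real_mx_row.
  by move=> j; rewrite mxE eqxx; case: (j == i); rewrite /= ?lexx ?ler01.
pose u := \sum_i row i B *+ Num.truncn (c 0 i).
have Hu : nat_span H u by apply: nat_span_sum => i _; apply: nat_spanMn.
suff Hr : nat_span H (v - u) by rewrite -(subrK u v); apply: nat_spanD.
apply: (HH (\row_i (c 0 i - (Num.truncn (c 0 i))%:R))).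
  move=> i; rewrite mxE; have /truncn_itv/andP[] := c0 i.
  by rewrite -natr1; lra.
rewrite real_mxB vc real_mx_sum !mulmx_row_sum -sumrB; apply: eq_bigr => i _.
by rewrite mxE real_mxMn scalerBl scaler_nat.
Qed.

Lemma min_hilbert_basis_exists B : exists H, min_hilbert_basis (cone_of R B) H.
Proof.
have [H0 H0h] := hilbert_basis_exists B.
pose P k := `[< exists2 H, hilbert_basis (cone_of R B) H & #|` H| = k >].
have exP : exists k, P k by exists #|` H0|; apply/asboolP; exists H0.
case: (ex_minnP exP) => k /asboolP[H Hh Hk] kmin; exists H; split=> // H' H'h H'H.
apply/eqP; rewrite eqEfcard H'H Hk; apply: kmin.
by apply/asboolP; exists H'.
Qed.

End HilbertBases.

(** * Derivations, and Chvatal-Gomory rounding by a Hilbert step *)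
Section Derivations.
Variables (R : realType) (n : nat).
Implicit Types (T : set 'rV[int]_n) (t : 'rV[int]_n) (w : 'rV[R]_n).

Definition support_function (S : set 'cV[int]_n) (beta : 'rV[int]_n -> int) :=
  (forall t s, S s -> (t *m s) 0 0 <= beta t) /\
  (forall t, exists2 s, S s & beta t = (t *m s) 0 0).

Variables (S : set 'cV[int]_n) (beta : 'rV[int]_n -> int).
Hypothesis bS : support_function S beta.

(** [derives T w m] is the cone of the inequalities w x <= m that follow from
    t x <= beta t for t in [T] by linear reasoning.  Working with this cone
    instead of the polyhedron avoids linear programming duality. *)
Inductive derives T : 'rV[R]_n -> R -> Prop :=
| derives_gen t : T t -> derives T (real_mx R t) (beta t)%:~R
| derives_zero : derives T 0 0
| derives_add w1 w2 m1 m2 : derives T w1 m1 -> derives T w2 m2 ->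
    derives T (w1 + w2) (m1 + m2)
| derives_scale a w m : 0 <= a -> derives T w m -> derives T (a *: w) (a * m)
| derives_weaken w m m' : m <= m' -> derives T w m -> derives T w m'.

Definition bounds_everything T : Prop := forall w, exists m, derives T w m.

Lemma derives_sum T (I : Type) (r : seq I) (w : I -> 'rV[R]_n) (m : I -> R) :
  (forall i, derives T (w i) (m i)) ->
  derives T (\sum_(i <- r) w i) (\sum_(i <- r) m i).
Proof.
move=> D; elim: r => [|i r IH]; rewrite ?big_nil ?big_cons.
  exact: derives_zero.
exact: derives_add.
Qed.

Lemma derives_sound T w m (x : 'cV[R]_n) :
  (forall t, T t -> (real_mx R t *m x) 0 0 <= (beta t)%:~R) ->
  derives T w m -> (w *m x) 0 0 <= m.
Proof.
move=> Tx; elim=> {w m}; first exact: Tx.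
- by rewrite mul0mx mxE.
- by move=> w1 w2 m1 m2 _ h1 _ h2; rewrite mulmxDl mxE lerD.
- by move=> a w m a0 _ h; rewrite -scalemxAl mxE ler_wpM2l.
- by move=> w m m' mm _ h; apply: le_trans mm.
Qed.

Definition supported_by T p (A : 'M[int]_(p, n)) (y : 'rV[R]_p) w (m : R) : Prop :=
  [/\ rows_of A `<=` T, forall i, 0 <= y 0 i, w = y *m real_mx R A
    & \sum_i y 0 i * (beta (row i A))%:~R <= m].

Lemma derives_supported T w m : derives T w m ->
  exists p (A : 'M[int]_(p, n)) y, supported_by T A y w m.
Proof.
elim=> {w m} [t Tt||w1 w2 m1 m2 _ [p1 [A1 [y1 [T1 y10 -> b1]]]] _
   [p2 [A2 [y2 [T2 y20 -> b2]]]]|a w m a0 _ [p [A [y [TA y0 -> b]]]]|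
   w m m' mm _ [p [A [y [TA y0 wE b]]]]].
- exists 1%N, t, 1%:M; split.
  + by move=> _ [i ->]; rewrite row_id.
  + by move=> i; rewrite (ord1 i) mxE.
  + by rewrite mul1mx.
  + by rewrite big_ord1 mxE mul1r row_id.
- exists 0%N, 0, 0; split=> //; [by move=> v [[]] | by case | | by rewrite big_ord0].
  by rewrite mul0mx.
- exists (p1 + p2)%N, (col_mx A1 A2), (row_mx y1 y2); split.
  + move=> _ [i ->]; rewrite -[i]fintype.splitK; case: fintype.split => j /=.
      by rewrite rowKu; apply: T1; exists j.
    by rewrite rowKd; apply: T2; exists j.
  + by move=> i; rewrite mxE; case: fintype.split.
  + have -> : real_mx R (col_mx A1 A2) = col_mx (real_mx R A1) (real_mx R A2).
      exact: map_col_mx.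
    by rewrite mul_row_col.
  + rewrite big_split_ord /=; apply: lerD.
      by under eq_bigr do rewrite row_mxEl rowKu.
    by under eq_bigr do rewrite row_mxEr rowKd.
- exists p, A, (a *: y); split=> //.
  + by move=> i; rewrite mxE mulr_ge0.
  + by rewrite scalemxAl.
  + under eq_bigr do rewrite mxE -mulrA.
    by rewrite -mulr_sumr ler_wpM2l.
- by exists p, A, y; split=> //; apply: le_trans mm.
Qed.

(** Any dependency will do up to its sign: if the cost of [z] is made nonpositive
    and [z] has no negative entry, then evaluating the dependency at a point of
    [S] shows that the cost is zero, and [- z] is as good. *)
Lemma dependency p (A : 'M[int]_(p, n)) : ~~ row_free (real_mx R A) ->
  exists z : 'rV[R]_p, [/\ z *m real_mx R A = 0,
    \sum_i z 0 i * (beta (row i A))%:~R <= 0 & exists i, z 0 i < 0].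
Proof.
rewrite -kermx_eq0 => /rowV0Pn[z /sub_kermxP zA z0].
pose sg (u : 'rV[R]_p) := \sum_i u 0 i * (beta (row i A))%:~R.
have sgN u : sg (- u) = - sg u.
  by rewrite /sg -sumrN; apply: eq_bigr => i _; rewrite mxE mulNr.
have zsg (u : 'rV[R]_p) : u *m real_mx R A = 0 -> (forall i, 0 <= u 0 i) -> 0 <= sg u.
  move=> uA u0; have [_ /(_ 0)[s Ss _]] := bS.
  have <- : ((u *m real_mx R A) *m real_mx R s) 0 0 = 0 by rewrite uA mul0mx mxE.
  rewrite (mulmx_row_sum u) mulmx_suml summxE; apply: ler_sum => i _.
  rewrite -scalemxAl mxE ler_wpM2l// -real_mxM mxE ler_int.
  by case: bS => + _; apply.
have neg (u : 'rV[R]_p) : u != 0 -> (forall i, 0 <= u 0 i) -> exists i, (- u) 0 i < 0.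
  move=> /eqP u0 up; apply: contrapT => /forallNP np; apply: u0.
  apply/rowP => i; rewrite mxE; have := np i; have := up i; rewrite mxE; lra.
wlog sz : z zA z0 / sg z <= 0.
  move=> W; have [sz|sz] := leP (sg z) 0; first exact: (W z).
  by apply: (W (- z)); rewrite ?mulNmx ?zA ?oppr0 ?oppr_eq0 ?sgN//; lra.
have [[i zi]|/forallNP np] := pselect (exists i, z 0 i < 0).
  by exists z; split=> //; exists i.
have zp i : 0 <= z 0 i by have := np i; lra.
exists (- z); split; [by rewrite mulNmx zA oppr0| |exact: neg].
by rewrite -/(sg _) sgN; have := zsg z zA zp; lra.
Qed.

(** Caratheodory's reduction.  Moving the coefficients along a [dependency] until
    one vanishes does not increase the bound and removes a row. *)
Lemma supported_row_free T p (A : 'M[int]_(p, n)) y w m :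
  supported_by T A y w m ->
  exists p' (A' : 'M[int]_(p', n)) y', supported_by T A' y' w m /\
    row_free (real_mx R A').
Proof.
elim: p A y => [|p IH] A y sA.
  by exists 0%N, A, y; split=> //; rewrite /row_free -leqn0 rank_leq_row.
have [fA|/dependency[z [zA zb [i0 zi0]]]] := boolP (row_free (real_mx R A)).
  by exists p.+1, A, y.
have [TA y0 wE yb] := sA.
pose q i := y 0 i / - z 0 i.
have [i zi imin] := @Order.TotalTheory.arg_minP _ _ _ i0 (fun i => z 0 i < 0) q zi0.
have q0 : 0 <= q i by rewrite divr_ge0// oppr_ge0 ltW.
pose y' := y + q i *: z.
have y'i : y' 0 i = 0 by rewrite !mxE /q; field; rewrite lt_eqF.
have y'0 j : 0 <= y' 0 j.
  rewrite !mxE; have [zj|zj] := ltP (z 0 j) 0; last by rewrite addr_ge0// mulr_ge0.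
  have := imin j zj; rewrite {2}/q ler_pdivlMr ?oppr_gt0//; lra.
have y'b : \sum_j y' 0 j * (beta (row j A))%:~R <= m.
  apply: le_trans yb; rewrite -subr_ge0 -sumrB.
  have -> : \sum_j (y 0 j * (beta (row j A))%:~R - y' 0 j * (beta (row j A))%:~R)
     = q i * (- \sum_j z 0 j * (beta (row j A))%:~R).
    by rewrite -sumrN mulr_sumr; apply: eq_bigr => j _; rewrite !mxE; ring.
  by rewrite mulr_ge0// oppr_ge0.
have rr j : row j (row' i A) = row (lift i j) A by apply/rowP => k; rewrite !mxE.
apply: (IH (row' i A) (col' i y')); split.
- by move=> _ [j ->]; apply: TA; exists (lift i j).
- by move=> j; rewrite mxE.
- have -> : w = y' *m real_mx R A by rewrite wE mulmxDl -scalemxAl zA scaler0 addr0.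
  rewrite !mulmx_row_sum (bigD1_ord i)//= y'i scale0r add0r; apply: eq_bigr => j _.
  by rewrite [col' i y' 0 j]mxE rr.
- move: y'b; rewrite (bigD1_ord i)//= y'i mul0r add0r; congr (_ <= _).
  apply: eq_bigr => j _.
  by rewrite [col' i y' 0 j]mxE rr.
Qed.

Lemma row_free_extend T p (A : 'M[int]_(p, n)) : bounds_everything T ->
  row_free (real_mx R A) -> (p < n)%N ->
  exists2 t, T t & row_free (real_mx R (col_mx A t)).
Proof.
move=> bT fA pn.
have [t Tt tA] : exists2 t, T t & ~~ (real_mx R t <= real_mx R A)%MS.
  apply: contrapT => /forall2NP no.
  have TA t : T t -> (real_mx R t <= real_mx R A)%MS.
    by move=> Tt; case: (no t) => // /negP; rewrite negbK.
  have DA w m : derives T w m -> (w <= real_mx R A)%MS.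
    elim=> {w m} //; [exact: sub0mx | by move=> *; apply: addmx_sub|].
    by move=> *; apply: scalemx_sub.
  have : (1%:M <= real_mx R A)%MS.
    apply/row_subP => i; have [m] := bT (row i 1%:M); exact: DA.
  move/mxrankS; rewrite mxrank1 => /leq_trans/(_ (rank_leq_row _)).
  by rewrite leqNgt pn.
exists t => //; have -> : real_mx R (col_mx A t) = col_mx (real_mx R A) (real_mx R t).
  exact: map_col_mx.
apply: inj_row_free => v; rewrite -[v]hsubmxK mul_row_col.
set v1 := lsubmx v; set v2 := rsubmx v; rewrite (mx11_scalar v2) mul_scalar_mx.
have [->|c0] := eqVneq (v2 0 0) 0.
  rewrite scale0r addr0 => v1A; have -> : v1 = 0.
    by apply: (row_free_inj fA); rewrite v1A mul0mx.
  by rewrite raddf0 row_mx0.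
move=> E; case/negP: tA; rewrite -(scalerK c0 (real_mx R t)).
have -> : v2 0 0 *: real_mx R t = - v1 *m real_mx R A.
  by rewrite mulNmx; apply/eqP; rewrite -addr_eq0 addrC E.
by rewrite scalemx_sub// submxMl.
Qed.

Lemma supported_basis T d p (A : 'M[int]_(p, n)) y w m :
  bounds_everything T -> n = (p + d)%N ->
  supported_by T A y w m -> row_free (real_mx R A) ->
  exists (B : 'M[int]_n) y', supported_by T B y' w m /\ row_free (real_mx R B).
Proof.
move=> bT; elim: d p A y => [|d IH] p A y nE sA fA.
  have pn : p = n by rewrite nE addn0.
  by clear nE; subst p; exists A, y.
have pn : (p < n)%N by lia.
have [t Tt fAt] := row_free_extend bT fA pn.
have [TA y0 wE yb] := sA.
apply: (IH (p + 1)%N (col_mx A t) (row_mx y 0)) => //; first lia.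
split.
- move=> _ [i ->]; rewrite -[i]fintype.splitK; case: fintype.split => j /=.
    by rewrite rowKu; apply: TA; exists j.
  by rewrite rowKd row_id.
- by move=> i; rewrite mxE; case: fintype.split => j //; rewrite mxE.
- have -> : real_mx R (col_mx A t) = col_mx (real_mx R A) (real_mx R t).
    exact: map_col_mx.
  by rewrite mul_row_col mul0mx addr0.
- rewrite big_split_ord /= [X in _ + X]big1 => [|j _].
    by rewrite addr0; under eq_bigr do rewrite row_mxEl rowKu.
  by rewrite row_mxEr mxE mul0r.
Qed.

Lemma derives_basis T w m : bounds_everything T -> derives T w m ->
  exists (B : 'M[int]_n) y, supported_by T B y w m /\ row_free (real_mx R B).
Proof.
move=> bT /derives_supported[p [A [y sA]]].
have [p' [A' [y' [sA' fA']]]] := supported_row_free sA.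
apply: (@supported_basis T (n - p') p' A' y') => //.
by rewrite subnKC// -(eqP fA') rank_leq_col.
Qed.

(** Let x be the point where the inequalities of the basis supporting the
    derivation are tight, and expand [t] in the Hilbert basis.  For each element
    h, [beta h <= h x], so the sum of the integers [beta h] is an integer
    at most [t x], which is at most [m]. *)
Lemma derives_round T t m (g : int) : bounds_everything T ->
  derives T (real_mx R t) m -> m < (g + 1)%:~R ->
  derives (hilbert_step R T) (real_mx R t) g%:~R.
Proof.
move=> bT /(derives_basis bT)[B [y [[TB y0 tE yb] fB]]] mg.
have [H HB] := min_hilbert_basis_exists R B.
have [[HC HS] _] := HB.
have [c tc] : nat_span H t by apply: HS; exists y.
have TH h : h \in H -> hilbert_step R T h by move=> hH; exists B, H.
pose b : 'cV[R]_n := \col_i (beta (row i B))%:~R.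
have uB : real_mx R B \in unitmx by rewrite -row_free_unit.
pose x := invmx (real_mx R B) *m b.
have comb (l : 'rV[R]_n) : ((l *m real_mx R B) *m x) 0 0
    = \sum_i l 0 i * (beta (row i B))%:~R.
  rewrite -mulmxA mulKVmx// mxE; apply: eq_bigr => i _; by rewrite mxE.
have hx h : h \in H -> (beta h)%:~R <= (real_mx R h *m x) 0 0.
  move=> /HC[l [l0 hl]]; rewrite hl comb; have [bge /(_ h)[s Ss ->]] := bS.
  have -> : ((h *m s) 0 0)%:~R = (real_mx R h *m real_mx R s) 0 0 :> R.
    by rewrite -real_mxM [RHS]mxE.
  rewrite hl (mulmx_row_sum l) mulmx_suml summxE; apply: ler_sum => i _.
  by rewrite -scalemxAl mxE ler_wpM2l// -real_mxM mxE ler_int bge.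
pose k : int := \sum_(h <- H) beta h *+ c h.
have kg : k <= g.
  rewrite -ltzD1 -(ltr_int R); apply: le_lt_trans mg; apply: le_trans yb.
  rewrite -comb -tE tc real_mx_sum mulmx_suml summxE /k rmorph_sum /=.
  rewrite !big_seq; apply: ler_sum => h hH.
  rewrite real_mxMn -[_ *+ c h in leRHS]scaler_nat -scalemxAl mxE mulr_natl.
  by rewrite rmorphMn /= lerMn2r hx ?orbT.
apply: (@derives_weaken _ _ k%:~R); first by rewrite ler_int.
rewrite tc real_mx_sum /k rmorph_sum /= !big_seq.
elim/big_ind2: _ => [|? ? ? ? ? ?|h hH]; first exact: derives_zero.
  exact: derives_add.
rewrite real_mxMn rmorphMn /= -scaler_nat -[X in derives _ _ X]mulr_natl.
by apply: derives_scale; [exact: ler0n | apply/derives_gen/TH].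
Qed.

Lemma derives_step T w m : bounds_everything T ->
  derives T w m -> derives (hilbert_step R T) w m.
Proof.
move=> bT; elim=> {w m}.
- move=> t Tt; apply: (derives_round bT (derives_gen Tt)).
  by rewrite ltr_int ltzD1.
- exact: derives_zero.
- by move=> *; apply: derives_add.
- by move=> *; apply: derives_scale.
- by move=> w m m' mm _; apply: derives_weaken.
Qed.

Lemma bounds_everything_step T : bounds_everything T ->
  bounds_everything (hilbert_step R T).
Proof. by move=> bT w; have [m wm] := bT w; exists m; apply: derives_step. Qed.

End Derivations.

(** * Finitely many roundings suffice inside the unit cube *)
Section Completeness.
Variables (R : realType) (n : nat).

Definition cube_point (y : 'I_n -> bool) : 'cV[int]_n := \col_i (y i)%:R.

(** The face of the cube where x_i = y_i for all i >= j is the set where this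
    functional attains its maximum [corner_level y j] on the cube.  For j = 0 it
    is the vertex y, and lowering the level by 1 removes that vertex alone. *)
Definition corner_normal (y : 'I_n -> bool) (j : nat) : 'rV[int]_n :=
  \row_(i < n) (if (j <= i)%N then (if y i then 1 else -1) else 0).

Definition corner_level (y : 'I_n -> bool) (j : nat) : int :=
  \sum_(i < n) (if (j <= i)%N then (y i)%:R else 0).

Definition cuts_out (S : set 'cV[int]_n) (T : set 'rV[int]_n) : Prop :=
  [/\ forall i, T (delta_mx 0 i), forall i, T (- delta_mx 0 i)
    & forall y, S (cube_point y) \/ T (corner_normal y 0)].

Variables (S : set 'cV[int]_n) (beta : 'rV[int]_n -> int) (T0 : set 'rV[int]_n).
Hypothesis bS : support_function S beta.
Hypothesis Scube : S `<=` range cube_point.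
Hypothesis cut0 : cuts_out S T0.

Let T k := iter k (@hilbert_step R n) T0.
Let D k : 'rV[R]_n -> R -> Prop := derives beta (T k).

Lemma corner_normal_dot y z :
  (corner_normal y 0 *m cube_point z) 0 0 =
  corner_level y 0 - \sum_i (y i != z i)%:R.
Proof.
rewrite mxE /corner_level -sumrB; apply: eq_bigr => i _.
by rewrite !mxE /=; case: (y i); case: (z i).
Qed.

Lemma corner_normal_bound y : ~ S (cube_point y) ->
  beta (corner_normal y 0) <= corner_level y 0 - 1.
Proof.
move=> Sy; have [_ /(_ (corner_normal y 0))[s Ss ->]] := bS.
have [z _ zs] := Scube Ss; rewrite -zs corner_normal_dot lerD2l lerN2.
have [i yz] : exists i, y i != z i.
  apply: contrapT => /forallNP E; apply: Sy; suff -> : y = z by rewrite zs.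
  by apply/funext => i; apply/eqP; apply: contrapT => /negP /(E i).
by rewrite (bigD1 i)//= yz lerDl sumr_ge0.
Qed.

Lemma beta_delta i : beta (delta_mx 0 i) <= 1 /\ beta (- delta_mx 0 i) <= 0.
Proof.
have E z : ((delta_mx 0 i : 'rV_n) *m cube_point z) 0 0 = (z i)%:R.
  by rewrite -rowE !mxE.
split.
  have [_ /(_ (delta_mx 0 i))[s /Scube[z _ <-] ->]] := bS.
  by rewrite E; case: (z i).
have [_ /(_ (- delta_mx 0 i))[s /Scube[z _ <-] ->]] := bS.
by rewrite mulNmx mxE E; case: (z i).
Qed.

Lemma derives_cube (w : 'rV[R]_n) : D 0 w (\sum_i Num.max (w 0 i) 0).
Proof.
have [Tp Tn _] := cut0.
have {1}-> : w = \sum_i w 0 i *: real_mx R (delta_mx 0 i).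
  rewrite [w in LHS]row_sum_delta; apply: eq_bigr => i _; congr (_ *: _).
  by apply/rowP => j; rewrite !mxE; case: (_ && _).
apply: derives_sum => i; have [b1 b0] := beta_delta i.
have [wi|wi] := leP 0 (w 0 i).
  rewrite -[X in derives _ _ _ X]mulr1; apply: derives_scale => //.
  apply: (@derives_weaken _ _ _ _ _ (beta (delta_mx 0 i))%:~R).
    by rewrite -[1]/(1%:~R) ler_int.
  exact/derives_gen/Tp.
rewrite -[w 0 i]opprK scaleNr -scalerN -real_mxN.
rewrite -[X in derives _ _ _ X](mulr0 (- w 0 i)).
apply: derives_scale; first by rewrite oppr_ge0 ltW.
apply: (@derives_weaken _ _ _ _ _ (beta (- delta_mx 0 i))%:~R).
  by rewrite lerz0.
exact/derives_gen/Tn.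
Qed.

Lemma bounds_everything_iter k : bounds_everything R beta (T k).
Proof.
elim: k => [|k IH]; last exact: (bounds_everything_step bS).
by move=> w; exists (\sum_i Num.max (w 0 i) 0); apply: derives_cube.
Qed.

Lemma derives_mono k k' w m : (k <= k')%N -> D k w m -> D k' w m.
Proof.
move=> /subnK <-; elim: (k' - k)%N => // d IH /IH.
exact/(derives_step bS)/bounds_everything_iter.
Qed.

Lemma derives_corner y j :
  D 0 (real_mx R (corner_normal y j)) (corner_level y j)%:~R.
Proof.
have := derives_cube (real_mx R (corner_normal y j)).
rewrite /corner_level rmorph_sum /=; congr (D 0 _ _); apply: eq_bigr => i _.
by rewrite !mxE; case: (j <= i)%N; case: (y i) => /=;
  rewrite ?maxxx// /Num.max; case: ifP => //; lra.
Qed.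

Lemma derives_round_iter k (t : 'rV[int]_n) m (g : int) :
  D k (real_mx R t) m -> m < (g + 1)%:~R -> D k.+1 (real_mx R t) g%:~R.
Proof. exact/(derives_round bS)/bounds_everything_iter. Qed.

(** A derived bound [gamma] on [c] that exceeds the true one can be lowered by 1.
    The bound on c x + M (corner_normal y j) x that combines [gamma] with the
    cube is first lowered for the vertices of the cube (j = 0), and then for
    larger and larger faces; for j = n the face is the whole cube and the corner
    functional vanishes. *)
Section Decrease.
Variables (c : 'rV[int]_n) (gamma : int) (M : nat) (k0 : nat).
Hypothesis M0 : (0 < M)%N.
Hypothesis cM : forall i, (`|c 0%R i| <= M)%N.
Hypothesis cD : D k0 (real_mx R c) gamma%:~R.
Hypothesis cb : beta c <= gamma - 1.

Let phi y j := c + corner_normal y j *+ M.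
Let lev y j := gamma + corner_level y j *+ M.

Lemma tilted_valid k y j : (k0 <= k)%N ->
  D k (real_mx R (phi y j)) (lev y j)%:~R.
Proof.
move=> k0k; rewrite /phi /lev real_mxD real_mxMn rmorphD rmorphMn /=.
apply: derives_add; first exact: derives_mono cD.
rewrite -scaler_nat -[X in derives _ _ _ X]mulr_natl.
by apply: derives_scale => //; apply: derives_mono (derives_corner y j).
Qed.

(** If the vertex [y] is a point of [S], then it already satisfies the stronger
    bound and the large weight [M] makes it the maximizer over the cube.
    Otherwise the inequality removing [y] supplies the gain. *)
Lemma tilted_strict_vertex y : D k0 (real_mx R (phi y 0)) (lev y 0 - 1)%:~R.
Proof.
have [Sy|Sy] := pselect (S (cube_point y)).
  have cy : (c *m cube_point y) 0 0 <= gamma - 1.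
    by apply: le_trans cb; have [+ _] := bS; apply.
  apply: derives_mono (leq0n _) _.
  apply: derives_weaken (derives_cube _).
  have -> : \sum_i Num.max (real_mx R (phi y 0) 0 i) 0 =
      (\sum_i Num.max (phi y 0 0 i) 0)%:~R.
    rewrite rmorph_sum; apply: eq_bigr => i _; rewrite mxE.
    by rewrite !maxEle lerz0; case: ifP.
  rewrite ler_int /lev addrAC; apply: le_trans
    (_ : (c *m cube_point y) 0 0 + corner_level y 0 *+ M <= _); last first.
    by rewrite lerD2r.
  rewrite mxE /corner_level -sumrMnl -big_split; apply: ler_sum => i _ /=.
  rewrite !mxE mulmxnE !mxE /=; have := cM i.
  by case: (y i) => /= ?; rewrite ?mulNrn /Num.max; case: ifP; lia.
have Ty : T0 (corner_normal y 0) by have [_ _ /(_ y)[]] := cut0.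
have Dy : D k0 (real_mx R (corner_normal y 0)) (corner_level y 0 - 1)%:~R.
  apply: derives_mono (leq0n _) _.
  apply: derives_weaken (derives_gen _ _ Ty).
  by rewrite ler_int corner_normal_bound.
apply: (@derives_weaken _ _ _ _ _ (gamma%:~R + M%:R * (corner_level y 0 - 1)%:~R)).
  by rewrite -[M%:R]/(M%:Z%:~R) -intrM -intrD ler_int /lev; nia.
rewrite /phi real_mxD real_mxMn -scaler_nat; apply: derives_add => //.
exact: derives_scale.
Qed.

(** Let f x <= L be the bound on the larger face and e its free coordinate.  The
    two smaller faces give (f - M e) x <= L - 1 and (f + M e) x <= L + M - 1.
    Scaling the first by 1/M and adding 1 - 1/M times f x <= L leaves
    (f - e) x <= L - 1/M, which rounds to L - 1.  Adding M times this to the second gives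
    (M + 1) f x <= (M + 1) L - 1, which rounds to f x <= L - 1. *)
Lemma tilted_strict j : (j <= n)%N -> forall y,
  exists k, D k (real_mx R (phi y j)) (lev y j - 1)%:~R.
Proof.
elim: j => [_|j IH jn] y; first by exists k0; apply: tilted_strict_vertex.
pose o := Ordinal jn.
pose y_ b i := if i == o then b else y i.
have E b : phi (y_ b) j = phi y j.+1 + (if b then 1 else -1) *: (delta_mx 0 o *+ M)
   /\ lev (y_ b) j = lev y j.+1 + (if b then M%:Z else 0).
  have lt_o (i : 'I_n) : i != o -> (j <= i)%N = (j < i)%N.
    by rewrite -val_eqE /= leq_eqVlt eq_sym => /negbTE ->.
  split.
    rewrite /phi -addrA; congr (_ + _); apply/rowP => i.
    rewrite !mxE !mulmxnE !mxE /= /y_.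
    have [->|io] := eqVneq i o; first by rewrite leqnn ltnn; case: b => /=; lia.
    by rewrite lt_o// mul0rn mulr0 addr0.
  rewrite /lev -addrA; congr (_ + _); rewrite /corner_level (bigD1 o)//=.
  rewrite [in RHS](bigD1 o)//= leqnn ltnn add0r /y_ eqxx mulrnDl [LHS]addrC.
  congr (_ + _); last by case: b => /=; rewrite ?mul0rn ?natz.
  by congr (_ *+ _); apply: eq_bigr => i io; rewrite (negbTE io) lt_o.
have [k_0 h0] := IH (ltnW jn) (y_ false); have [k_1 h1] := IH (ltnW jn) (y_ true).
pose k := maxn k0 (maxn k_0 k_1).
have k_0k : (k_0 <= k)%N by rewrite !leq_max leqnn orbT.
have k_1k : (k_1 <= k)%N by rewrite !leq_max leqnn !orbT.
move: (derives_mono k_0k h0) (derives_mono k_1k h1) => {}h0 {}h1.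
have hv : D k (real_mx R (phi y j.+1)) (lev y j.+1)%:~R.
  by apply: tilted_valid; rewrite leq_max leqnn.
move: h0 h1; have [-> ->] := E true; have [-> ->] := E false.
rewrite scale1r scaleN1r; set f := phi y j.+1; set L := lev y j.+1 => h0 h1.
pose F := real_mx R f; pose G := real_mx R (delta_mx 0 o : 'rV_n).
have MR : 1 <= M%:R :> R by rewrite ler1n.
have a1 : D k.+1 (real_mx R (f - delta_mx 0 o)) (L - 1)%:~R.
  apply: (@derives_round_iter _ _ (M%:R^-1 * (L + 0 - 1)%:~R + (1 - M%:R^-1) * L%:~R)).
    have -> : real_mx R (f - delta_mx 0 o) =
      M%:R^-1 *: real_mx R (f - delta_mx 0 o *+ M) + (1 - M%:R^-1) *: real_mx R f.
      rewrite !real_mxB real_mxMn -/F -/G -[G *+ M]scaler_nat; clearbody F G.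
      by apply/rowP => i; rewrite !mxE; field; lra.
    apply: derives_add; apply: derives_scale => //.
      by rewrite subr_ge0 invf_le1; lra.
  rewrite addr0 subrK rmorphB /=.
  have : 0 < M%:R^-1 :> R by rewrite invr_gt0; lra.
  lra.
exists k.+2; apply: (@derives_round_iter _ _ ((M%:R + 1)^-1 *
   ((L + M%:Z - 1)%:~R + M%:R * (L - 1)%:~R))).
  have -> : real_mx R f = (M%:R + 1)^-1 *:
     (real_mx R (f + delta_mx 0 o *+ M) + M%:R *: real_mx R (f - delta_mx 0 o)).
    rewrite real_mxB real_mxD real_mxMn -/F -/G -[G *+ M]scaler_nat; clearbody F G.
    by apply/rowP => i; rewrite !mxE; field; lra.
  apply: derives_scale; first by rewrite invr_ge0; lra.
  apply: derives_add; first exact: derives_mono h1.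
  exact: derives_scale.
have -> : (L + M%:Z - 1)%:~R + M%:R * (L - 1)%:~R = (M%:R + 1) * L%:~R - 1 :> R.
  by rewrite !(intrD, intrN); ring.
rewrite subrK mulrBr mulKf; last lra.
by rewrite ltrBlDr ltrDl mulr1 invr_gt0; lra.
Qed.

Lemma derives_decrease : exists k, D k (real_mx R c) (gamma - 1)%:~R.
Proof.
have [k] := tilted_strict (leqnn n) (fun=> false).
have z (i : 'I_n) : (n <= i)%N = false by apply/negbTE; rewrite -ltnNge.
rewrite /phi /lev.
have -> : corner_normal (fun=> false) n = 0.
  by apply/rowP => i; rewrite !mxE z.
have -> : corner_level (fun=> false) n = 0.
  by rewrite /corner_level big1// => i _; rewrite z.
by rewrite !mul0rn !addr0 => h; exists k.
Qed.

End Decrease.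

(** The cube provides some bound, which [derives_decrease] brings down to the
    true one. *)
Lemma derives_complete (c : 'rV[int]_n) : exists k, D k (real_mx R c) (beta c)%:~R.
Proof.
have [m m0] := bounds_everything_iter 0 (real_mx R c).
have {m0} [k [d kd]] : exists k (d : nat), D k (real_mx R c) (beta c + d%:Z)%:~R.
  exists 0%N, (Num.truncn `|m - (beta c)%:~R|).+1; apply: derives_weaken m0.
  rewrite rmorphD /= -lerBlDl; apply: le_trans (ler_norm _) _.
  by apply/ltW/truncnS_gt.
have [M cM] := entries_le_exists (\matrix_(i < n) c).
elim: d k kd => [|d IH] k kd; first by exists k; rewrite addr0 in kd.
have cM' i : (`|c 0%R i| <= M.+1)%N by apply: leqW; have := cM i i; rewrite mxE.
have cb : beta c <= beta c + d.+1%:Z - 1 by lia.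
have [k'] := derives_decrease (ltn0Sn M) cM' kd cb.
have -> : beta c + d.+1%:Z - 1 = beta c + d%:Z by lia.
exact: IH.
Qed.

End Completeness.

(** * Systems of inequalities and their iterates *)
Section Systems.
Variables (R : realType) (n : nat).
Implicit Types (s : seq ('rV[int]_n * int)) (t : 'rV[int]_n) (x : 'cV[R]_n).

Definition system_mx s : 'M[int]_(size s, n) :=
  \matrix_(i < size s) (nth (0, 0) s i).1.

Definition system_rhs s : 'cV[int]_(size s) :=
  \col_(i < size s) (nth (0, 0) s i).2.

Lemma rows_of_system s t :
  rows_of (system_mx s) t <-> exists2 p, p \in s & t = p.1.
Proof.
split=> [[i ->]|[p ps ->]].
  by exists (nth (0, 0) s i); [exact: mem_nth | rewrite rowK].
have ip : (index p s < size s)%N by rewrite index_mem.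
by exists (Ordinal ip); rewrite rowK /= nth_index.
Qed.

Lemma mulmx_row_entry m (A : 'M[int]_(m, n)) x i :
  (real_mx R A *m x) i 0 = (real_mx R (row i A) *m x) 0 0.
Proof. by rewrite real_mx_row -row_mul [RHS]mxE. Qed.

Lemma polyhedron_system s x : polyhedron R (system_mx s) (system_rhs s) x <->
  forall p, p \in s -> (real_mx R p.1 *m x) 0 0 <= p.2%:~R.
Proof.
split=> [sx p ps|sx i].
  have ip : (index p s < size s)%N by rewrite index_mem.
  have := sx (Ordinal ip); rewrite (mulmx_row_entry (system_mx s)) rowK.
  by rewrite [system_rhs s _ _]mxE /= nth_index.
rewrite (mulmx_row_entry (system_mx s)) rowK [system_rhs s _ _]mxE.
by apply: sx; apply: mem_nth.
Qed.

Lemma primitive_unit t i : `|t ord0 i|%N = 1%N -> primitive t.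
Proof. by move=> ti; rewrite /primitive (bigD1 i)//= ti gcd1n. Qed.

Lemma hilbert_iter_entries_le m (A : 'M[int]_(m, n)) k t :
  entries_le A 1 -> hilbert_iter R A k t -> entries_le t (n ^ k).
Proof.
move=> A1; elim: k t => [|k IH] t; first by move=> [i ->] a b; rewrite mxE.
move=> [B [H [[TB fB] HB tH]]].
have [c c01 tc] := min_hilbert_basis_le1 fB HB tH.
rewrite expnS; apply: entries_le_comb c01 tc => i j.
by have := IH (row i B) (TB _ (ex_intro _ i erefl)) 0 j; rewrite mxE.
Qed.

Lemma conv_hull_le (X : set 'cV[R]_n) (w : 'rV[R]_n) (m : R) x :
  (forall p, X p -> (w *m p) 0 0 <= m) -> conv_hull X x -> (w *m x) 0 0 <= m.
Proof.
move=> Xm [k [p [a [Xp a0 a1 ->]]]]; rewrite mulmx_sumr summxE.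
have -> : m = \sum_(i < k) a i * m by rewrite -mulr_suml a1 mul1r.
apply: ler_sum => i _.
by rewrite -scalemxAr mxE ler_wpM2l// Xm.
Qed.

Lemma small_slack p (a c : 'I_p -> R) : (forall i, 0 < a i) ->
  exists2 e, 0 < e & forall i, e * c i < a i.
Proof.
move=> a0; pose D := 1 + \sum_i `|c i| / a i.
have q0 i : 0 <= `|c i| / a i by rewrite divr_ge0// ltW.
have D0 : 0 < D by rewrite ltr_pwDl// sumr_ge0.
exists D^-1; first by rewrite invr_gt0.
move=> i; rewrite mulrC ltr_pdivrMr//; apply: le_lt_trans (ler_norm _) _.
rewrite mulrC -ltr_pdivrMr// /D (bigD1 i)//=.
have : 0 <= \sum_(j | j != i) `|c j| / a j by apply: sumr_ge0.
lra.
Qed.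

End Systems.

(** * Simplices spanned by 0/1 points *)
Section SimplexSystem.
Variables (R : realType) (n : nat) (Z : 'M[int]_n).
Hypothesis Z01 : forall i j, Z i j = 0 \/ Z i j = 1.
Hypothesis uZ : real_mx R Z \in unitmx.
Implicit Types (t : 'rV[int]_n) (x : 'cV[R]_n).

Definition simplex_vertices : set 'cV[int]_n :=
  [set s | s = 0 \/ exists i, s = (row i Z)^T].

Definition simplex_support t : int :=
  \big[Order.max/0]_(i < n) (t *m (row i Z)^T) 0 0.

Local Notation S := simplex_vertices.
Local Notation beta := simplex_support.

Lemma simplex_supportP : support_function S beta.
Proof.
split=> [t s [->|[i ->]]|t].
- by rewrite mulmx0 mxE; apply: bigmax_ge_id.
- exact: (le_bigmax_cond _ (fun i => (t *m (row i Z)^T) 0 0)).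
- rewrite /beta; elim/big_ind: _ => [||i _].
  + by exists 0; [left | rewrite mulmx0 mxE].
  + by move=> a b [sa Sa ->] [sb Sb ->]; rewrite maxEle; case: ifP => _;
      [exists sb | exists sa].
  + by exists (row i Z)^T => //; right; exists i.
Qed.

Lemma simplex_vertices_cube : S `<=` range (@cube_point n).
Proof.
move=> s [->|[i ->]].
  by exists (fun=> false) => //; apply/colP => j; rewrite !mxE.
exists (fun j => Z i j == 1) => //; apply/colP => j; rewrite !mxE.
by case: (Z01 i j) => ->.
Qed.

Definition simplex_system : seq ('rV[int]_n * int) :=
  [seq (delta_mx 0 i, 1) | i <- enum 'I_n] ++
  [seq (- delta_mx 0 i, 0) | i <- enum 'I_n] ++
  [seq (corner_normal y 0, corner_level y 0 - 1) |
     y : {ffun 'I_n -> bool} <- enum {: {ffun 'I_n -> bool}} &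
     ~~ `[< S (cube_point y) >]].

Local Notation A := (system_mx simplex_system).
Local Notation b := (system_rhs simplex_system).

Lemma mem_simplex_system p : p \in simplex_system <->
  [\/ exists i, p = (delta_mx 0 i, 1), exists i, p = (- delta_mx 0 i, 0)
    | exists2 y, ~ S (cube_point y) & p = (corner_normal y 0, corner_level y 0 - 1)].
Proof.
rewrite /simplex_system !mem_cat; split.
  case/or3P => /mapP[i + ->]; [by constructor 1; exists i|by constructor 2; exists i|].
  by rewrite mem_filter => /andP[/asboolP Sy _]; constructor 3; exists i.
case=> [[i ->]|[i ->]|[y Sy ->]]; apply/or3P.
- by constructor 1; apply/mapP; exists i; rewrite ?mem_enum.
- by constructor 2; apply/mapP; exists i; rewrite ?mem_enum.
- constructor 3; apply/mapP; exists (finfun y).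
    rewrite mem_filter mem_enum andbT; apply/asboolP; congr (~ S _): Sy.
    by apply/colP => i; rewrite !mxE ffunE.
  congr (_, _); first by apply/rowP => i; rewrite !mxE ffunE.
  by congr (_ - 1); apply: eq_bigr => i _; rewrite ffunE.
Qed.

Lemma simplex_cuts_out : cuts_out S (rows_of A).
Proof.
split=> [i|i|y]; last have [Sy|Sy] := pselect (S (cube_point y)); first 2 last.
- by left.
- right; apply/rows_of_system; exists (corner_normal y 0, corner_level y 0 - 1) => //.
  by apply/mem_simplex_system; constructor 3; exists y.
- apply/rows_of_system; exists (delta_mx 0 i, 1) => //.
  by apply/mem_simplex_system; constructor 1; exists i.
- apply/rows_of_system; exists (- delta_mx 0 i, 0) => //.
  by apply/mem_simplex_system; constructor 2; exists i.
Qed.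

Lemma simplex_system_primitive i : primitive (row i A).
Proof.
have /rows_of_system[p ps ->] : rows_of A (row i A) by exists i.
case/mem_simplex_system: ps => [[j ->]|[j ->]|[y Sy ->]] /=.
- by apply: (@primitive_unit _ _ j); rewrite !mxE !eqxx.
- by apply: (@primitive_unit _ _ j); rewrite !mxE !eqxx.
- have [j _] : exists j, y j.
    apply: contrapT => /forallNP y0; apply: Sy; left.
    by apply/colP => j; rewrite !mxE; case: (y j) (y0 j).
  by apply: (@primitive_unit _ _ j); rewrite !mxE /=; case: (y j).
Qed.

Lemma simplex_system_entries : entries_le A 1.
Proof.
move=> i j.
have /rows_of_system[p ps E] : rows_of A (row i A) by exists i.
have -> : A i j = p.1 0 j by rewrite -E [RHS]mxE.
case/mem_simplex_system: ps => [[k ->]|[k ->]|[y Sy ->]] /=.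
- by rewrite !mxE; case: (_ && _).
- by rewrite !mxE; case: (_ && _).
- by rewrite !mxE /=; case: (y j).
Qed.

Lemma simplex_system_rank : \rank (real_mx R A) = n.
Proof.
apply/eqP; rewrite -[_ == n]/(row_full (real_mx R A)) -sub1mx.
apply/row_subP => j.
have [Tp _ _] := simplex_cuts_out; have [i di] := Tp j.
have -> : row j 1%:M = row i (real_mx R A).
  by rewrite -real_mx_row -di row1; apply/rowP => k; rewrite !mxE; case: (_ && _).
exact: row_sub.
Qed.

Lemma simplex_polyhedronP x : polyhedron R A b x <->
  [/\ forall i, 0 <= x i 0 <= 1 &
    forall y, ~ S (cube_point y) ->
      (real_mx R (corner_normal y 0) *m x) 0 0 <= (corner_level y 0 - 1)%:~R].
Proof.
have dx i : (real_mx R (delta_mx 0 i : 'rV_n) *m x) 0 0 = x i 0.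
  have -> : real_mx R (delta_mx 0 i : 'rV_n) = delta_mx 0 i.
    by apply/rowP => k; rewrite !mxE; case: (_ && _).
  by rewrite -rowE mxE.
rewrite polyhedron_system; split=> [sx|[x01 cx] p /mem_simplex_system].
  split=> [i|y Sy]; last first.
    by apply: (sx (_, _)); apply/mem_simplex_system; constructor 3; exists y.
  have := sx (delta_mx 0 i, 1); rewrite /= dx => -> /=; last first.
    by apply/mem_simplex_system; constructor 1; exists i.
  have := sx (- delta_mx 0 i, 0); rewrite /= real_mxN mulNmx mxE dx => /(_ _)/wrap[].
    by apply/mem_simplex_system; constructor 2; exists i.
  by rewrite oppr_le0 => ->.
case=> [[i ->]|[i ->]|[y Sy ->]] /=; last exact: cx.
- by rewrite dx; case/andP: (x01 i).
- by rewrite real_mxN mulNmx mxE dx oppr_le0; case/andP: (x01 i).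
Qed.

Lemma simplex_polyhedron_cube : polyhedron R A b `<=` unit_cube R n.
Proof. by move=> x /simplex_polyhedronP[]. Qed.

Lemma simplex_integer_points :
  polyhedron R A b `&` integer_points R n = @real_mx R n 1 @` S.
Proof.
apply/seteqP; split=> x /=.
  move=> [/simplex_polyhedronP[x01 cx] [s _ sx]]; exists s => //.
  have sE : s = cube_point (fun i => s i 0 == 1).
    apply/colP => i; rewrite mxE; have := x01 i; rewrite -sx mxE ler0z lerz1.
    by case: (s i 0) => [[|[|k]]|k].
  rewrite sE; apply: contrapT => /[dup] Sy /cx.
  rewrite -sx -real_mxM [X in X <= _]mxE ler_int {2}sE corner_normal_dot.
  by rewrite big1 ?subr0 => [|i _]; [lia | rewrite eqxx].
move=> [s Ss <-]; split; last by exists s.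
have [z _ zs] := simplex_vertices_cube Ss.
apply/simplex_polyhedronP; split=> [i|y Sy].
  by rewrite mxE -zs mxE; case: (z i); rewrite /= ?lexx ?ler01.
rewrite -real_mxM [X in X <= _]mxE ler_int.
apply: le_trans (corner_normal_bound simplex_supportP simplex_vertices_cube Sy).
by have [+ _] := simplex_supportP; apply.
Qed.

Let hullE : integer_hull R A b = conv_hull (@real_mx R n 1 @` S).
Proof. by rewrite /integer_hull simplex_integer_points. Qed.

Lemma simplex_hull_coordinates x (c : 'rV[R]_n) : x^T = c *m real_mx R Z ->
  (forall i, 0 <= c 0 i) -> \sum_i c 0 i <= 1 -> integer_hull R A b x.
Proof.
move=> xc c0 c1; rewrite hullE.
exists n.+1, (fun i => if unlift ord0 i is Some j then real_mx R (row j Z)^T else 0).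
exists (fun i => if unlift ord0 i is Some j then c 0 j else 1 - \sum_i c 0 i).
split.
- move=> i; case: unliftP => [j _|_]; last by exists 0; [left | rewrite real_mx0].
  by exists (row j Z)^T => //; right; exists j.
- by move=> i; case: unliftP => [j _|_] //; rewrite subr_ge0.
- rewrite big_ord_recl unlift_none; under [X in _ + X]eq_bigr do rewrite liftK.
  by rewrite subrK.
- rewrite big_ord_recl unlift_none scaler0 add0r; under eq_bigr do rewrite liftK.
  apply: trmx_inj; rewrite xc mulmx_row_sum raddf_sum; apply: eq_bigr => j _ /=.
  by apply/rowP => k; rewrite !mxE.
Qed.

Let detZ0 : \det Z != 0.
Proof.
move: uZ; rewrite unitmxE unitfE; apply: contra => /eqP d0.
have -> : \det (real_mx R Z) = (\det Z)%:~R by rewrite (det_map_mx (intmul 1)).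
by rewrite d0.
Qed.

(* the functional -|det Z| c_i, where c_i is the i-th coordinate of a point in
   the basis of the rows of Z *)
Let w_ i : 'rV[int]_n := - (Num.sg (\det Z) *: (col i (\adj Z))^T).

Let w_row i j : (w_ i *m (row j Z)^T) 0 0 = - (`|\det Z| *+ (i == j)).
Proof.
rewrite mulNmx -scalemxAl -trmx_mul mxE [X in - X]mxE; congr (- _).
have -> : (row j Z *m col i (\adj Z))^T 0 0 = (\det Z) *+ (i == j).
  by rewrite mxE colE mulmxA -row_mul mul_mx_adj -colE !mxE eq_sym.
by rewrite mulrnAr -normrEsg.
Qed.

(** The facets have integer normals, the columns of the adjugate of [Z] up to
    sign and their sum, and each of the corresponding inequalities is derived at
    some stage.  At a common later stage all of them follow from the iterate with
    right-hand sides [beta]. *)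
Lemma simplex_describes_at : exists k, describes_hull_at R A b k.
Proof.
have bS := simplex_supportP.
have complete := derives_complete R bS simplex_vertices_cube simplex_cuts_out.
have [k_ kP] := choice (fun i => complete (w_ i)).
have [k0 k0P] := complete (- \sum_i w_ i).
pose k := maxn k0 (\max_i k_ i).
have mono := derives_mono bS simplex_vertices_cube simplex_cuts_out.
exists k.
pose L := [seq (t, beta t) | t <- enum_fset (bounded_rows n (n ^ k)) &
             `[< hilbert_iter R A k t >]].
have memL t : hilbert_iter R A k t -> (t, beta t) \in L.
  move=> Tt; apply/mapP; exists t => //; rewrite mem_filter; apply/andP; split.
    exact/asboolP.
  exact/bounded_rowsP/(hilbert_iter_entries_le simplex_system_entries Tt).
have Lmem p : p \in L -> hilbert_iter R A k p.1 /\ p.2 = beta p.1.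
  by move=> /mapP[t]; rewrite mem_filter => /andP[/asboolP Tt _] ->.
exists (size L), (system_mx L), (system_rhs L); split.
  apply/seteqP; split=> [t /rows_of_system[p /Lmem[? _] ->] //|t Tt].
  by apply/rows_of_system; exists (t, beta t) => //; apply: memL.
apply/seteqP; split=> x.
  rewrite hullE => hx; apply/polyhedron_system => p /Lmem[_ ->].
  apply: conv_hull_le hx => _ [s Ss <-]; rewrite -real_mxM [X in X <= _]mxE ler_int.
  by have [+ _] := bS; apply.
move=> /polyhedron_system Lx.
have valid t k' : (k' <= k)%N ->
    derives beta (iter k' (@hilbert_step R n) (rows_of A))
      (real_mx R t) (beta t)%:~R ->
    (real_mx R t *m x) 0 0 <= (beta t)%:~R.
  move=> k'k /(mono _ _ _ _ _ k'k); apply: derives_sound => u Tu.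
  exact: (Lx _ (memL u Tu)).
pose c := x^T *m invmx (real_mx R Z).
have xc : x^T = c *m real_mx R Z by rewrite mulmxKV.
have wx i : (real_mx R (w_ i) *m x) 0 0 = - (`|\det Z|%:~R * c 0 i).
  have -> : (real_mx R (w_ i) *m x) 0 0 =
      (real_mx R (w_ i) *m (c *m real_mx R Z)^T) 0 0.
    by rewrite -xc trmxK.
  rewrite mulmx_row_sum raddf_sum mulmx_sumr summxE (bigD1 i)//= big1 => [|j ji].
    rewrite linearZ /= -scalemxAr mxE addr0.
    have -> : (real_mx R (row i Z))^T = real_mx R (row i Z)^T.
      by apply/colP => a; rewrite !mxE.
    by rewrite -real_mxM [X in _ * X]mxE w_row eqxx mulr1n intrN; ring.
  rewrite linearZ /= -scalemxAr mxE.
  have -> : (real_mx R (row j Z))^T = real_mx R (row j Z)^T.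
    by apply/colP => a; rewrite !mxE.
  by rewrite -real_mxM [X in _ * X]mxE w_row eq_sym (negbTE ji) mulr0n oppr0 mulr0.
have d0 : 0 < `|\det Z|%:~R :> R by rewrite ltr0z normr_gt0.
have bw i : beta (w_ i) <= 0.
  have [_ /(_ (w_ i))[s [->|[j ->]] ->]] := bS; first by rewrite mulmx0 mxE.
  by rewrite w_row oppr_le0 mulrn_wge0.
have bw0 : beta (- \sum_i w_ i) <= `|\det Z|.
  have [_ /(_ (- \sum_i w_ i))[s [->|[j ->]] ->]] := bS; first by rewrite mulmx0 mxE.
  rewrite mulNmx mulmx_suml mxE summxE (bigD1 j)//= big1 => [|i ij].
    by rewrite w_row eqxx addr0 opprK.
  by rewrite w_row (negbTE ij) mulr0n oppr0.
apply: (simplex_hull_coordinates xc) => [i|].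
  have ki : (k_ i <= k)%N by rewrite leq_max (leq_bigmax i) orbT.
  have := valid _ _ ki (kP i); rewrite wx => h.
  rewrite -(pmulr_rge0 _ d0) -oppr_le0; apply: le_trans h _.
  by rewrite lerz0.
have := valid _ _ (leq_maxl _ _) k0P.
rewrite real_mxN real_mx_sum mulNmx mulmx_suml mxE summxE.
under eq_bigr do rewrite wx; rewrite sumrN opprK -mulr_sumr => h.
rewrite -(ler_pM2l d0) mulr1; apply: le_trans h _.
by rewrite ler_int.
Qed.

Lemma simplex_small_chvatal_rank : exists k, is_small_chvatal_rank R A b k.
Proof.
pose P k := `[< describes_hull_at R A b k >].
have exP : exists k, P k.
  by have [k Pk] := simplex_describes_at; exists k; apply/asboolP.
case: (ex_minnP exP) => k /asboolP Pk kmin; exists k; split=> // j Pj.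
by apply: kmin; apply/asboolP.
Qed.

(** If no row of the iterate were normal to the facet opposite to the vertex
    [row r Z], every nonzero row would be slack at the barycentre of the facet,
    since being tight there means being tight at all its vertices.  One could
    then leave the simplex through the barycentre without violating the
    description. *)
Lemma simplex_facet_row k (v : 'cV[R]_n) r : real_mx R Z *m v = delta_mx r 0 ->
  describes_hull_at R A b k ->
  exists t a, [/\ hilbert_iter R A k t, a != 0 & real_mx R t = a *: v^T].
Proof.
move=> Zv [p [Ak [b' [rowsk hullk]]]].
apply: contrapT => no.
have zv i : (real_mx R (row i Z) *m v) 0 0 = (i == r)%:R.
  by rewrite -mulmx_row_entry Zv mxE andbT.
have hull_in s : S s -> polyhedron R Ak b' (real_mx R s).
  move=> Ss; rewrite -hullk hullE.
  exists 1%N, (fun=> real_mx R s), (fun=> 1); split=> [_|_||].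
  - by exists s.
  - exact: ler01.
  - by rewrite big_ord1.
  - by rewrite big_ord1 scale1r.
have hull_v x : polyhedron R Ak b' x -> 0 <= (v^T *m x) 0 0.
  rewrite -hullk hullE -oppr_le0 => /(@conv_hull_le _ _ _ (- v^T) 0).
  rewrite mulNmx [(- (v^T *m x)) _ _]mxE; apply=> _ [s Ss <-].
  rewrite mulNmx mxE oppr_le0; case: Ss => [->|[i ->]].
    by rewrite real_mx0 mulmx0 mxE.
  have -> : real_mx R (row i Z)^T = (real_mx R (row i Z))^T.
    by apply/colP => j; rewrite !mxE.
  by rewrite -trmx_mul mxE zv.
have tz i (t : 'rV[int]_n) : (real_mx R t *m real_mx R (row i Z)^T) 0 0 =
     (real_mx R Z *m (real_mx R t)^T) i 0.
  rewrite !mxE; apply: eq_bigr => j _; rewrite !mxE; ring.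
(* the weight 1/n of the vertex 0 is implicit *)
pose x0 : 'cV[R]_n := n%:R^-1 *: \sum_(i | i != r) real_mx R (row i Z)^T.
have n0 : 0 < n%:R :> R by rewrite ltr0n; have := ltn_ord r; lia.
pose val_ j i := (real_mx R (row j Ak) *m real_mx R (row i Z)^T) 0 0.
have valb j i : val_ j i <= (b' j 0)%:~R.
  rewrite /val_ -mulmx_row_entry; apply: hull_in; by right; exists i.
have b0 j : 0 <= (b' j 0)%:~R :> R.
  have /(_ j) := @hull_in 0 (or_introl erefl).
  by rewrite real_mx0 mulmx0 mxE.
have x0E j : (real_mx R (row j Ak) *m x0) 0 0 = n%:R^-1 * \sum_(i | i != r) val_ j i.
  by rewrite -scalemxAr mxE mulmx_sumr summxE.
have slackE j : (b' j 0)%:~R - (real_mx R (row j Ak) *m x0) 0 0 =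
   n%:R^-1 * ((b' j 0)%:~R + \sum_(i | i != r) ((b' j 0)%:~R - val_ j i)).
  rewrite x0E sumrB mulrDr mulrBr addrA -mulrDr.
  have -> : (b' j 0)%:~R + \sum_(i | i != r) (b' j 0)%:~R = n%:R * (b' j 0)%:~R :> R.
    rewrite -(bigD1 r (P := xpredT) (F := fun=> (b' j 0)%:~R))//=.
    by rewrite sumr_const card_ord mulr_natl.
  by rewrite mulKf// lt0r_neq0.
have slack j : row j Ak = 0 \/ 0 < (b' j 0)%:~R - (real_mx R (row j Ak) *m x0) 0 0.
  have [->|tN0] := eqVneq (row j Ak) 0; [by left | right].
  rewrite slackE pmulr_rgt0 ?invr_gt0// lt0r.
  rewrite addr_ge0 ?sumr_ge0// => [|i _]; last first.
    by rewrite subr_ge0.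
  rewrite andbT; apply/negP; rewrite paddr_eq0 ?sumr_ge0// => [|i _]; last first.
    by rewrite subr_ge0.
  rewrite psumr_eq0 => [|i _]; last by rewrite subr_ge0.
  move=> /andP[/eqP bj0 /allP vj].
  have vj0 i : i != r -> val_ j i = 0.
    move=> ir; have := vj i (mem_index_enum i); rewrite ir bj0 sub0r oppr_eq0.
    by move/eqP.
  apply: no; exists (row j Ak), (val_ j r); split.
  - by rewrite -rowsk; exists j.
  - apply: contra_neq tN0 => vr0; apply: (@real_mx_inj R).
    rewrite real_mx0; apply: trmx_inj; rewrite trmx0.
    apply: (can_inj (mulKmx uZ)); rewrite mulmx0; apply/colP => i.
    rewrite -tz [RHS]mxE -/(val_ j i).
    by have [->|ir] := eqVneq i r; [|exact: vj0].
  - apply: trmx_inj; apply: (can_inj (mulKmx uZ)).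
    rewrite linearZ /= trmxK -scalemxAr Zv.
    apply/colP => i; rewrite -tz -/(val_ j i) !mxE andbT.
    by have [->|ir] := eqVneq i r; rewrite ?mulr1// mulr0 vj0.
pose sl j := if row j Ak == 0 then 1
  else (b' j 0)%:~R - (real_mx R (row j Ak) *m x0) 0 0.
have sl0 j : 0 < sl j.
  by rewrite /sl; case: eqP => // t0; case: (slack j).
have [e e0 eP] := small_slack (fun j => - val_ j r) sl0.
have := hull_v (x0 - e *: real_mx R (row r Z)^T).
have -> : (v^T *m (x0 - e *: real_mx R (row r Z)^T)) 0 0 = - e.
  have vz i : (v^T *m real_mx R (row i Z)^T) 0 0 = (i == r)%:R.
    have -> : real_mx R (row i Z)^T = (real_mx R (row i Z))^T.
      by apply/colP => j; rewrite !mxE.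
    by rewrite -trmx_mul mxE zv.
  rewrite mulmxBr -!scalemxAr mulmx_sumr 3!mxE summxE big1 => [|i /negbTE ir].
    by rewrite mulr0 sub0r mxE vz eqxx mulr1.
  by rewrite vz ir.
rewrite oppr_ge0 leNgt e0 => /(_ _)/wrap[] // j.
rewrite mulmx_row_entry -[b' j ord0]/(b' j 0).
have -> : (real_mx R (row j Ak) *m (x0 - e *: real_mx R (row r Z)^T)) 0 0
    = (real_mx R (row j Ak) *m x0) 0 0 - e * val_ j r.
  by rewrite mulmxBr -(scalemxAr e) [LHS]mxE [X in _ + X]mxE [X in _ - X]mxE.
have := eP j; rewrite /sl; case: eqP => [t0 _|_]; last lra.
by rewrite /val_ t0 real_mx0 !mul0mx [X in X - _]mxE [X in e * X]mxE mulr0 subr0.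
Qed.

(** The multiple of [v] that is a row of the iterate has a nonzero integer entry
    at [j], where [v] is 1; hence the multiplier is at least 1 in absolute
    value. *)
Lemma simplex_rank_lower_bound k (v : 'cV[R]_n) r i j :
  real_mx R Z *m v = delta_mx r 0 -> v j 0 = 1 ->
  describes_hull_at R A b k -> `|v i 0| <= (n ^ k)%:R.
Proof.
move=> Zv vj /(simplex_facet_row Zv)[t [a [Tt a0 ta]]].
have te l : (t 0 l)%:~R = a * v l 0 :> R.
  by have := congr1 (fun M : 'rV_n => M 0 l) ta; rewrite !mxE.
have t1 : 1 <= `|a|.
  have := te j; rewrite vj mulr1 => aE; rewrite -aE -intr_norm ler1z.
  by rewrite -gtz0_ge1 normr_gt0; apply: contra_neq a0 => t0; rewrite -aE t0.
have : `|(t 0 i)%:~R| <= (n ^ k)%:R :> R.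
  rewrite -intr_norm -natr_absz ler_nat.
  exact: (hilbert_iter_entries_le simplex_system_entries Tt).
by rewrite te normrM; apply: le_trans; rewrite ler_peMl.
Qed.

End SimplexSystem.

(** * Asymptotics *)
Section Final.
Variable R : realType.

Definition hard_system n (K : nat) : Prop :=
  exists (m : nat) (A : 'M[int]_(m, n)) (b : 'cV[int]_m),
    [/\ \rank (real_mx R A) = n, forall i : 'I_m, primitive (row i A),
        polyhedron R A b `<=` unit_cube R n
      & exists k : nat, is_small_chvatal_rank R A b k /\ (K <= n ^ k)%N].

Lemma real_mx_zero_one n (Z : 'M[R]_n) : zero_one Z ->
  exists2 Zi : 'M[int]_n, forall i j, Zi i j = 0 \/ Zi i j = 1 & real_mx R Zi = Z.
Proof.
move=> Z01; exists (\matrix_(i, j) (Z i j == 1)%:R).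
  by move=> i j; rewrite mxE; case: (_ == _); [right | left].
apply/matrixP => i j; rewrite !mxE.
by case: (Z01 i j) => ->; rewrite ?eqxx// eq_sym oner_eq0.
Qed.

Lemma hard_system_of_ratio n (Z : 'M[R]_n) v r i j (K : nat) :
  solves_unit Z v r -> v j 0 = 1 -> K%:R <= `|v i 0| -> hard_system n K.
Proof.
move=> [/real_mx_zero_one[Zi Z01 <-] uZ Zv] vj Kv.
have [k kP] := simplex_small_chvatal_rank Z01 uZ.
exists _, (system_mx (simplex_system Zi)), (system_rhs (simplex_system Zi)); split.
- exact: simplex_system_rank.
- exact: simplex_system_primitive.
- exact: simplex_polyhedron_cube.
- exists k; split=> //; rewrite -(ler_nat R); apply: le_trans Kv _.
  by have [dk _] := kP; apply: (simplex_rank_lower_bound _ _ _ Zv vj dk).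
Qed.


Lemma hard_system_trivial n : hard_system n 0.
Proof.
have id01 (i j : 'I_n) : (1%:M : 'M[int]_n) i j = 0 \/ (1%:M : 'M[int]_n) i j = 1.
  by rewrite mxE; case: (_ == _); [right | left].
have u1 : real_mx R (1%:M : 'M[int]_n) \in unitmx.
  have -> : real_mx R (1%:M : 'M[int]_n) = 1%:M.
    by apply/matrixP => i j; rewrite !mxE; case: (_ == _).
  exact: unitmx1.
have [k kP] := simplex_small_chvatal_rank id01 u1.
exists _, (system_mx (simplex_system 1%:M)).
exists (system_rhs (simplex_system 1%:M)); split.
- exact: simplex_system_rank.
- exact: simplex_system_primitive.
- exact: simplex_polyhedron_cube.
- by exists k.
Qed.

(** One more unknown equal to 1, in front of an amplifier of order n - 1, provides
    the small entry of the facet normal. *)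
Lemma hard_system_exists n m : (0 < n)%N -> exists e : nat,
  ((m - 8) * (n - (2 ^ m + 2)) <= 2 * e)%N /\ hard_system n (2 ^ e).
Proof.
case: n => // n _; have [->|n0] := posnP n.
  exists 0%N; split; first by rewrite (_ : 1 - _ = 0)%N ?muln0//; lia.
  apply: (hard_system_of_ratio (solves_unit1 R (0 : 'I_1)) (i := 0) (j := 0));
    by rewrite mxE ?normr1.
have [e [be [Z [v [r [i [SZ Xv]]]]]]] := large_amplifier R m n0.
exists e; split; first by rewrite addn2 subSS; rewrite addn1 in be.
have := solves_unit_glue 0 (solves_unit1 R (0 : 'I_1)) SZ => SG.
apply: (hard_system_of_ratio SG (i := rshift 1 i) (j := lshift n 0)).
  by rewrite col_mxEu mxE.
by rewrite col_mxEd !mxE /= mulN1r normrN natrX.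
Qed.

(** Blocks of order about n / 2^(slow n) are chosen: since slow n tends to
    infinity the incomplete last block is negligible, and since slow n is
    o(log n) the logarithm of the order is still ~ log n. *)
Definition slow n := trunc_log 2 (trunc_log 2 n).+1.

Definition defect n : R := n%:R * ((slow n)%:R + 12) / (2 * 2 ^+ slow n).

Lemma succ_sqr_le_expn h : ((h.+1 * h.+1) <= 4 * 2 ^ h)%N.
Proof.
elim: h => // h IH; have [h1|h1] := leqP h 1; first by case: h h1 {IH} => [|[]].
by rewrite expnS; nia.
Qed.

Lemma defect_ratio_le n : defect n / n%:R <= 24 / (slow n).+1%:R.
Proof.
have [->|n0] := posnP n; first by rewrite invr0 mulr0 divr_ge0// ler0n.
rewrite /defect; set h := slow n.
have nR : n%:R != 0 :> R by rewrite pnatr_eq0 -lt0n.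
have P0 : 0 < 2 ^+ h :> R by rewrite exprn_gt0.
have h0 : 0 < h.+1%:R :> R by rewrite ltr0n.
have -> : n%:R * (h%:R + 12) / (2 * 2 ^+ h) / n%:R = (h%:R + 12) / (2 * 2 ^+ h) :> R.
  by field; rewrite nR expf_neq0// pnatr_eq0.
rewrite ler_pdivlMr// mulrAC ler_pdivrMr ?mulr_gt0//.
have : (h.+1 * h.+1)%:R <= (4 * 2 ^ h)%:R :> R by rewrite ler_nat succ_sqr_le_expn.
have : 0 <= h%:R :> R by rewrite ler0n.
by rewrite !natrM natrX -natr1; nra.
Qed.

Lemma defect_small : defect n / n%:R @[n --> \oo] --> (0 : R).
Proof.
apply/cvgr0Pnorm_lt => e e0.
pose K := (Num.truncn (24 / e)).+1.
exists (2 ^ 2 ^ K)%N => // n /= Kn.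
have n0 : (0 < n)%N by apply: leq_trans Kn; rewrite expn_gt0.
have hK : (K <= slow n)%N.
  by apply: trunc_log_max => //; apply: leqW; apply: trunc_log_max.
rewrite ger0_norm; last first.
  by rewrite /defect !mulr_ge0 ?invr_ge0 ?addr_ge0 ?mulr_ge0 ?exprn_ge0 ?ler0n.
apply: le_lt_trans (defect_ratio_le n) _.
rewrite ltr_pdivrMr ?ltr0n// mulrC -ltr_pdivrMr//.
apply: lt_le_trans (truncnS_gt _) _.
by rewrite ler_nat; apply: leqW.
Qed.

(** Put L = trunc_log 2 n, h = slow n and P = 2^h <= L + 1.  Taking logarithms,
    2 (L + 1) k >= (L - h - 8) (n - 2^(L-h) - 2).  Dividing by 2 (L + 1), the
    first factor loses (h + 9) / (L + 1) <= (h + 9) / P relatively and the second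
    one (2^(L-h) + 2) / n <= 3 / P, which add up to (h + 12) / P. *)
Lemma rank_arithmetic n e k : (0 < n)%N -> (2 ^ e <= n ^ k)%N ->
  (((trunc_log 2 n - slow n) - 8) *
     (n - (2 ^ (trunc_log 2 n - slow n) + 2)) <= 2 * e)%N ->
  n%:R / 2 - defect n <= k%:R :> R.
Proof.
move=> n0 ek be.
have /andP[Ln nL] := trunc_log_bounds (isT : 1 < 2)%N n0.
have /andP[hL Lh] := trunc_log_bounds (isT : 1 < 2)%N (ltn0Sn (trunc_log 2 n)).
rewrite -/(slow n) in hL Lh; rewrite /defect.
move: be hL Lh; set L := trunc_log 2 n in Ln nL *; set h := slow n => be hL Lh.
have elk : (e <= L.+1 * k)%N.
  rewrite -(leq_exp2l (m := 2))//; apply: leq_trans ek _.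
  by rewrite expnM; case: (k) => // k'; rewrite leq_exp2r// ltnW.
have hL1 : (h < L.+1)%N by apply: leq_trans hL; apply: ltn_expl.
have mhL : (2 ^ (L - h) * 2 ^ h <= n)%N by rewrite -expnD subnK.
have m1 : (0 < 2 ^ (L - h))%N by rewrite expn_gt0.
have {elk be} be : ((L - h - 8) * (n - (2 ^ (L - h) + 2)) <= 2 * (L.+1 * k))%N.
  by apply: leq_trans be _; rewrite leq_mul2l.
move: mhL m1 be hL; set M := (2 ^ (L - h))%N; set P := (2 ^ h)%N => mhL m1 be hL.
have P1 : (0 < P)%N by rewrite expn_gt0.
have PR : 2 ^+ h = P%:R :> R by rewrite natrX.
have P0 : 0 < P%:R :> R by rewrite ltr0n.
have nR : 0 < n%:R :> R by rewrite ltr0n.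
rewrite PR.
have [small|main] := boolP ((L - h < 8)%N || (n < M + 2)%N).
  have Ph : (P <= h + 12)%N by move: small => /orP[]; nia.
  have PhR : P%:R <= h%:R + 12 :> R by rewrite -natrD ler_nat.
  have : 1 <= (h%:R + 12) / P%:R :> R by rewrite ler_pdivlMr// mul1r.
  have -> : n%:R * (h%:R + 12) / (2 * P%:R) = n%:R / 2 * ((h%:R + 12) / P%:R) :> R.
    by field; rewrite gt_eqF.
  have : 0 <= k%:R :> R by rewrite ler0n.
  nra.
have {main} [m8 sn] : (8 <= L - h)%N /\ (M + 2 <= n)%N by lia.
have beR : (L%:R - h%:R - 8) * (n%:R - (M%:R + 2)) <= 2 * (L.+1%:R * k%:R) :> R.
  by rewrite -!natrD -!natrB -?natrM ?ler_nat //; lia.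
have l0 : 0 < L.+1%:R :> R by rewrite ltr0n.
have hLR : P%:R <= L.+1%:R :> R by rewrite ler_nat.
have mhLR : M%:R * P%:R <= n%:R :> R by rewrite -natrM ler_nat.
have MR : 1 <= M%:R :> R by rewrite ler1n.
have h0 : 0 <= h%:R :> R by rewrite ler0n.
rewrite -(ler_pM2l l0).
set u := n%:R / P%:R : R.
have nu : n%:R = u * P%:R by rewrite /u divfK// gt_eqF.
have uM : M%:R <= u by rewrite /u ler_pdivlMr.
have -> : n%:R * (h%:R + 12) / (2 * P%:R) = u * (h%:R + 12) / 2 :> R.
  by rewrite /u; field; rewrite gt_eqF.
have lu : n%:R * (h%:R + 9) <= L.+1%:R * (u * (h%:R + 9)).
  have -> : n%:R * (h%:R + 9) = P%:R * (u * (h%:R + 9)) by rewrite nu; ring.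
  by rewrite ler_wpM2r// mulr_ge0//; lra.
have lM : L.+1%:R * (M%:R + 2) <= L.+1%:R * (3 * u) by rewrite ler_pM2l//; lra.
have hM : 0 <= (h%:R + 9) * (M%:R + 2) :> R by apply: mulr_ge0; lra.
move: beR lu lM hM; rewrite -natr1; lra.
Qed.

End Final.

Theorem theorem5p5 (R : realType) :
  exists f : nat -> R,
    (f n / n%:R @[n --> \oo] --> (0 : R)) /\
    forall n : nat,
      exists (m : nat) (A : 'M[int]_(m, n)) (b : 'cV[int]_m),
        [/\ \rank (real_mx R A) = n,
            forall i : 'I_m, primitive (row i A),
            polyhedron R A b `<=` unit_cube R n
          & exists k : nat,
              is_small_chvatal_rank R A b k /\ n%:R / 2 - f n <= k%:R].
Proof.
exists (@defect R); split=> [|n]; first exact: defect_small.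
have [->|n0] := posnP n.
  have [m [A [b [rA pA cA [k [kP _]]]]]] := hard_system_trivial R 0.
  exists m, A, b; split=> //; exists k; split=> //.
  by rewrite /defect !mul0r subr0 ler0n.
have [e [be [m [A [b [rA pA cA [k [kP ek]]]]]]]] :=
  hard_system_exists R (trunc_log 2 n - slow n) n0.
by exists m, A, b; split=> //; exists k; split=> //; apply: rank_arithmetic ek be.
Qed.
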